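(* Let $U\subseteq\mathbb{R}^n$ be open, let $f:U\to\mathbb{R}^n$ be a $C^1$ vector field, and let $G$ be a Riemannian metric on $U$. Let $K\subset U$ be a non-empty, compact, connected and positively invariant set of the dynamical system $\dot x = f(x)$ which contains no equilibrium (i.e. $f(x)\neq 0$ for all $x\in K$). Suppose that for some $c'>0$ one has $\lambda'_G(x) < -c'$ for all $x\in K$, where $$\lambda'_G(x) = \max\left\{ w^{\mathrm T}\left(J(x)G(x) - \tfrac12 \dot G(x)\right) w \;:\; w\in\mathbb{R}^n,\ w^{\mathrm T}w = 1,\ w^{\mathrm T}f(x) = 0\right\}.$$ Then there is a unique periodic orbit of $\dot x = f(x)$. This periodic orbit is exponentially stable.
   Context: $J(x) = \frac{\partial f}{\partial x}(x)$ is the Jacobian matrix of $f$ at $x$. A Riemannian metric on $U$ is identified with its metric tensor $G=[g_{kl}]$, i.e. a $C^1$ map from $U$ to the symmetric $n\times n$ real matrices with $G(x)$ positive definite for every $x\in U$. $\dot G$ denotes the orbital derivative of $G$ along $f$: $\dot G(x) = \left[\sum_{j=1}^n f_j(x)\,\frac{\partial g_{kl}}{\partial x_j}(x)\right]_{k,l}$. A set $K$ is positively invariant if every solution of $\dot x=f(x)$ starting in $K$ remains in $K$ for all $t\ge 0$. A periodic orbit is the image of a non-constant periodic solution. A periodic orbit $\Omega$ is exponentially stable if it is orbitally stable (for every neighbourhood $V$ of $\Omega$ there is a neighbourhood $V'$ of $\Omega$ such that solutions starting in $V'$ exist and stay in $V$ for all $t\ge 0$) and there are $\nu>0$ and a neighbourhood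 $N$ of $\Omega$ such that for every solution $\phi$ with $\phi(0)\in N$ one has $\mathrm{dist}(\phi(t),\Omega)\,e^{\nu t}\to 0$ as $t\to\infty$.
   Formalization: Uniqueness is asserted among the periodic orbits contained in K, and the orbit lies in K; uniqueness in all of U is false, e.g. (1−r²)(4−r²)x + x^⊥ in the plane with K a thin annulus around r = 1 also has the periodic orbit r = 2. *)

(* Defs.v *)
From HB Require Import structures.
From mathcomp Require Export all_boot all_order all_algebra.
From mathcomp Require Export all_classical all_reals all_analysis.
Export Order.TTheory GRing.Theory Num.Theory numFieldNormedType.Exports.

Set Implicit Arguments.
Unset Strict Implicit.
Unset Printing Implicit Defensive.

Local Open Scope classical_set_scope.
Local Open Scope ring_scope.

(* R^n is 'cV[R]_n.  Fields on U are total functions, whose values outside U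
   are never used: every derivative below is taken at a point of the open
   set U. *)

(* The library's topology on 'cV[R]_n comes from the sup norm.  Continuity of
   every y |-> 'D_v g y amounts, in finite dimension, to continuity of the
   Frechet derivative. *)
Definition C1_on (R : realType) (n : nat) (W : normedModType R)
    (U : set 'cV[R]_n) (g : 'cV[R]_n -> W) : Prop :=
  forall x, U x ->
    differentiable g x /\
    forall v : 'cV[R]_n, {for x, continuous (fun y => 'D_v g y)}.

Definition basis_vec (R : realType) (n : nat) (j : 'I_n) : 'cV[R]_n :=
  delta_mx j 0.

(* The library's ['J f x] acts on row vectors, i.e. it is the transpose of the
   matrix [d f_i / d x_j]_(i, j). *)
Definition Jac (R : realType) (n : nat) (f : 'cV[R]_n -> 'cV[R]_n)
    (x : 'cV[R]_n) : 'M[R]_n :=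
  \matrix_(i < n, j < n) 'D_(basis_vec R j) (fun y => f y i 0) x.

Definition orbital_derivative (R : realType) (n : nat)
    (f : 'cV[R]_n -> 'cV[R]_n) (G : 'cV[R]_n -> 'M[R]_n) (x : 'cV[R]_n) :
    'M[R]_n :=
  \matrix_(k < n, l < n)
    \sum_(j < n) f x j 0 * 'D_(basis_vec R j) (fun y => G y k l) x.

Definition quad (R : realType) (n : nat) (A : 'M[R]_n) (w : 'cV[R]_n) : R :=
  (w^T *m A *m w) 0 0.

Definition riemannian_metric (R : realType) (n : nat) (U : set 'cV[R]_n)
    (G : 'cV[R]_n -> 'M[R]_n) : Prop :=
  C1_on U G /\
  forall x, U x ->
    (G x)^T = G x /\ forall w : 'cV[R]_n, w != 0 -> 0 < quad (G x) w.

(* For n >= 2 the set of admissible w is compact and non-empty, so that this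
   supremum is the maximum.  When n = 1 and f x != 0 it is empty and the
   supremum is the junk value 0; but in dimension 1 a non-empty compact
   positively invariant set always contains an equilibrium. *)
Definition lambda' (R : realType) (n : nat) (f : 'cV[R]_n -> 'cV[R]_n)
    (G : 'cV[R]_n -> 'M[R]_n) (x : 'cV[R]_n) : R :=
  sup [set quad (Jac f x *m G x - 2%:R^-1 *: orbital_derivative f G x) w
        | w in [set w : 'cV[R]_n | w^T *m w = 1%:M /\ w^T *m f x = 0]].

(* Solutions with a datum at time 0 live on an open interval around 0; as f is
   C^1, a solution on [0, T[ always extends to such an interval. *)
Definition solution (R : realType) (n : nat) (U : set 'cV[R]_n)
    (f : 'cV[R]_n -> 'cV[R]_n) (I : set R) (phi : R -> 'cV[R]_n) : Prop :=
  [/\ open I, is_interval I, I 0 &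
      forall t, I t -> U (phi t) /\ is_derive t 1 phi (f (phi t))].

(* No global existence is required of the solutions: for K compact it follows. *)
Definition positively_invariant (R : realType) (n : nat) (U : set 'cV[R]_n)
    (f : 'cV[R]_n -> 'cV[R]_n) (K : set 'cV[R]_n) : Prop :=
  forall (I : set R) (phi : R -> 'cV[R]_n),
    solution U f I phi -> K (phi 0) ->
    forall t, I t -> 0 <= t -> K (phi t).

Definition periodic_orbit (R : realType) (n : nat) (U : set 'cV[R]_n)
    (f : 'cV[R]_n -> 'cV[R]_n) (Omega : set 'cV[R]_n) : Prop :=
  exists (phi : R -> 'cV[R]_n) (T : R),
    [/\ solution U f setT phi, 0 < T, periodic phi T,
        (exists s t, phi s <> phi t) & Omega = range phi].

Definition euclidean_norm (R : realType) (n : nat) (v : 'cV[R]_n) : R :=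
  Num.sqrt (\sum_(i < n) v i 0 ^+ 2).

Definition dist (R : realType) (n : nat) (x : 'cV[R]_n)
    (A : set 'cV[R]_n) : R :=
  inf [set euclidean_norm (x - y) | y in A].

Definition orbitally_stable (R : realType) (n : nat) (U : set 'cV[R]_n)
    (f : 'cV[R]_n -> 'cV[R]_n) (Omega : set 'cV[R]_n) : Prop :=
  forall V, set_nbhs Omega V ->
  exists2 V', set_nbhs Omega V' &
    forall x, V' x ->
      (exists I phi, [/\ solution U f I phi, [set t | 0 <= t] `<=` I & phi 0 = x]) /\
      (forall I phi, solution U f I phi -> phi 0 = x ->
        forall t, I t -> 0 <= t -> V (phi t)).

Definition exponentially_stable (R : realType) (n : nat) (U : set 'cV[R]_n)
    (f : 'cV[R]_n -> 'cV[R]_n) (Omega : set 'cV[R]_n) : Prop :=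
  orbitally_stable U f Omega /\
  exists nu N, [/\ 0 < nu, set_nbhs Omega N &
    forall I phi, solution U f I phi -> [set t | 0 <= t] `<=` I -> N (phi 0) ->
      dist (phi t) Omega * expR (nu * t) @[t --> +oo] --> (0 : R)].

(* Main.v *)
Require Import Defs.
From mathcomp Require Import ring lra.

(** The symmetric matrix [G x] is read as a metric on covectors, so that its
   inverse [M x] measures displacements.  In terms of the covector [w = M z], the
   hypothesis on [lambda'] says that displacements [z] with [w] orthogonal to [f]
   are contracted by the flow in this metric.  Nothing is known along [f]; there
   the two points are only shifted in time against each other.

   The idea is to correct this time shift by feedback.  Next to a reference
   trajectory [x] in [K], a second point [y] is moved along its own trajectory, but
   with the speed [1 + a], where [a = - k f(x)^T M(x) (y - x)].  The linearization
   of the controlled equation at [y = x] is [J - k f f^T M], and by Finsler's lemma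
   ([finsler]) a large gain [k] makes it contracting in all directions.  Compactness
   of [K] gives uniform constants ([contraction_data]): any two controlled points
   near the same reference trajectory approach each other exponentially
   ([tracking_contraction]).  A controlled trajectory is a trajectory of the original
   equation run with a clock of rate between 1/2 and 3/2.

   Everything follows from this synchronisation.
   - Existence.  Some point [x] of [K] almost returns to itself after a long time
     [T]; moving the points near [x] under control for the time [T] contracts a ball
     around [x] into itself.  The fixed point of this map lies on a closed orbit
     ([periodic_point]), which is in [K] since it is shadowed by a trajectory in [K]
     ([shadowed_periodic_point]).
   - Uniqueness.  Two points of [K] at a distance below a fixed radius have
     trajectories that approach each other up to a change of time, so the basin of
     the closed orbit is open and closed in [K].  As [K] is connected, a second
     closed orbit would be attracted by the first ([periodic_point_on_orbit]).
   - Stability.  The points near the closed orbit are synchronised with points on it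
     ([orbit_attraction], [attracting_exponentially_stable]).

   Solutions are obtained by replacing [f] with a globally Lipschitz field that
   agrees with [f] near [K] ([lipschitz_extension]); it has a global flow by Picard
   iteration ([picard]), for which [K] is still positively invariant
   ([flow_positively_invariant]). *)

Set Implicit Arguments.
Unset Strict Implicit.
Unset Printing Implicit Defensive.

Local Open Scope classical_set_scope.
Local Open Scope ring_scope.

(** * Calculus in coordinates *)

Lemma ler_of_eq (R : numDomainType) (x y : R) : x = y -> x <= y.
Proof. by move=> ->. Qed.

Lemma coord_le_norm (R : realType) m n (A : 'M[R]_(m, n)) i j :
  `|A i j| <= `|A|.
Proof.
rewrite [leRHS]/Num.Def.normr/= mx_normrE.
exact: (le_bigmax _ _ (i, j)).
Qed.

Lemma norm_le_coord (R : realType) m n (A : 'M[R]_(m, n)) r :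
  0 <= r -> (forall i j, `|A i j| <= r) -> `|A| <= r.
Proof.
move=> r0 Ar; rewrite [leLHS]/Num.Def.normr/= mx_normrE.
by apply: bigmax_le => // -[i j] _; exact: Ar.
Qed.

Lemma is_derive_mxP (R : realType) (V : normedModType R) m n
    (A : V -> 'M[R]_(m, n)) (t v : V) (D : 'M[R]_(m, n)) :
  is_derive t v A D <->
  forall i j, is_derive t v (fun s => A s i j) (D i j).
Proof.
split=> [[dA AE] i j|dA].
  split; first exact: (derivable_mxP A t v).1.
  by rewrite -AE derive_mx// mxE.
have dvA : derivable A t v by apply/derivable_mxP => i j; case: (dA i j).
split=> //; rewrite derive_mx//; apply/matrixP => i j; rewrite mxE.
by case: (dA i j).
Qed.

Lemma cvg_mxP (R : realType) (T : Type) (F : set_system T) m n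
    (A : T -> 'M[R]_(m, n)) (D : 'M[R]_(m, n)) {FF : Filter F} :
  A @ F --> D <-> forall i j, (A s i j @[s --> F] --> D i j).
Proof.
split=> [AD i j|AD].
  apply/cvgrPdist_le => e e0.
  move/cvgrPdist_le : AD => /(_ _ e0); apply: filterS => s; apply: le_trans.
  by have := coord_le_norm (D - A s) i j; rewrite !mxE.
apply/cvgrPdist_le => e e0.
have h (p : 'I_m * 'I_n) : \forall s \near F, `|D p.1 p.2 - A s p.1 p.2| <= e.
  by move/cvgrPdist_le : (AD p.1 p.2) => /(_ _ e0).
apply: (@filterS _ F FF _ _ _ (filter_forall _ h)) => s hs.
apply: norm_le_coord; first exact: ltW.
by move=> i j; rewrite !mxE; exact: (hs (i, j)).
Qed.

Lemma derivable_continuous_mx (R : realType) m n (A : R -> 'M[R]_(m, n)) (t : R) D :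
  is_derive t 1 A D -> {for t, continuous A}.
Proof. by case=> dA _; apply/differentiable_continuous/derivable1_diffP. Qed.

Lemma nonincreasing_of_derive (R : realType) (u du : R -> R) (a b : R) :
  a <= b ->
  {within `[a, b], continuous u} ->
  (forall s : R, a < s < b -> is_derive s 1 u (du s) /\ du s <= 0) ->
  u b <= u a.
Proof.
rewrite le_eqVlt => /predU1P[->//|ab] cu hu.
have [|c cab ue] := @MVT _ u du _ _ ab _ cu.
  by move=> s sab; apply (hu s); rewrite in_itv/= in sab.
rewrite in_itv/= in cab; have [_ dc] := hu _ cab.
by rewrite -subr_le0 ue mulr_le0_ge0// subr_ge0 ltW.
Qed.

Lemma continuous_within (T U : topologicalType) (A : set T) (u : T -> U) :
  (forall x, A x -> {for x, continuous u}) -> {within A, continuous u}.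
Proof.
by move=> cu; apply: continuous_in_subspaceT => x; rewrite inE; exact: cu.
Qed.

(** Integration of a differential inequality with a barrier: the inequality is
   only known below the level [delta], which the solution of the comparison
   equation never reaches. *)
Lemma barrier_comparison (R : realType) (u du : R -> R) (b c delta : R) :
  0 <= b ->
  (forall s : R, 0 <= s <= b -> is_derive s 1 u (du s)) ->
  (forall s : R, 0 <= s <= b -> u s < delta -> du s <= c * u s) ->
  (forall s : R, 0 <= s <= b -> u 0 * expR (c * s) < delta) ->
  forall s : R, 0 <= s <= b -> u s <= u 0 * expR (c * s).
Proof.
move=> b0 dU hdu hd.
have key t : 0 <= t <= b -> (forall s, 0 < s < t -> u s < delta) ->
    u t <= u 0 * expR (c * t).
  move=> /andP[t0 tb] ut.
  pose v s := u s * expR (- c * s).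
  pose dv s := (du s - c * u s) * expR (- c * s).
  have dvE s : 0 <= s <= t -> is_derive s 1 v (dv s).
    move=> /andP[s0 st]; have sb : 0 <= s <= b by rewrite s0 (le_trans st).
    have := dU _ sb => ?.
    have ? : is_derive s 1 (fun s => expR (- c * s)) (expR (- c * s) * - c).
      apply: (@is_derive1_comp _ expR (fun s => - c * s)).
      apply: is_derive_eq.
      by rewrite /GRing.scale/= mulr1.
    rewrite /v /dv; apply: is_derive_eq.
    by rewrite /GRing.scale/=; ring.
  have : v t <= v 0.
    apply: (@nonincreasing_of_derive _ v dv) => //.
      apply: continuous_within => s /=; rewrite in_itv/= => /dvE[+ _].
      by move=> /derivable1_diffP/differentiable_continuous.
    move=> s /andP[s0 st]; split; first by apply: dvE; rewrite !ltW.
    rewrite /dv mulr_le0_ge0// ?expR_ge0// subr_le0 hdu//.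
      by rewrite ltW//= (le_trans (ltW st)).
    by apply: ut; rewrite s0.
  rewrite /v mulr0 expR0 mulr1 mulNr expRN.
  by rewrite ler_pdivrMr ?expR_gt0.
suff below s : 0 <= s <= b -> u s < delta.
  move=> s /andP[s0 sb]; apply: key; first by rewrite s0.
  move=> r /andP[r0 rs]; apply: below.
  by rewrite ltW//= (le_trans (ltW rs)).
move=> sb; rewrite ltNge; apply/negP => us.
pose S := [set r | 0 <= r <= b /\ delta <= u r].
have S0 : S !=set0 by exists s.
have lbS : lbound S 0 by move=> r [/andP[]].
have hiS : has_inf S by split=> //; exists 0.
have iS0 : 0 <= inf S by exact: lb_le_inf.
have iSb : inf S <= b.
  apply: (@le_trans _ _ s); first by apply: ge_inf => //; exists 0.
  by case/andP: sb.
have iS : 0 <= inf S <= b by rewrite iS0.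
have Slt r : 0 < r < inf S -> u r < delta.
  move=> /andP[r0 ri]; rewrite ltNge; apply/negP => ur.
  have : S r by split=> //; rewrite ltW//= (le_trans (ltW ri)).
  by move/(ge_inf hiS.2); rewrite leNgt ri.
have : u (inf S) < delta by apply: le_lt_trans (key _ iS Slt) _; exact: hd.
have cu : {for inf S, continuous u}.
  have [+ _] := dU _ iS.
  by move=> /derivable1_diffP/differentiable_continuous.
move=> uS; have /nbhs_ballP[e /= e0 he] : \forall r \near inf S, u r < delta.
  by exact: (cvgr_lt _ cu).
have [r Sr re] := inf_adherent e0 hiS.
have ir := ge_inf hiS.2 Sr.
suff /he /= : ball (inf S) e r by rewrite ltNge Sr.2.
by rewrite -ball_normE/= ler0_norm ?subr_le0// opprB ltrBlDl.
Qed.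

(** * Global solutions of Lipschitz differential equations *)

(** Measure-theoretic integration starts at a finite point; a function that
   vanishes on the negative half-line makes the starting point irrelevant. *)
Lemma primitive_of_vanishing (R : realType) (h : R -> R) :
  continuous h -> (forall t, t <= 0 -> h t = 0) ->
  exists P : R -> R, forall t : R, is_derive t 1 P (h t).
Proof.
move=> ch h0; pose P x := \int[@lebesgue_measure R]_(t in `[-1, x]) h t.
exists P => x; have [x0|x0] := ltP x 0.
  rewrite h0 ?ltW//; apply: (@near_eq_is_derive _ _ _ (cst 0)).
  have : \forall y \near x, y < 0 by exact: lt_nbhsl.
  apply: filterS => y y0; rewrite /P/=.
  rewrite (@eq_Rintegral _ _ _ _ _ (cst 0)); last first.
    move=> t; rewrite inE/= in_itv/= => /andP[_ ty].
    by rewrite h0// (le_trans ty)// ltW.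
  by rewrite Rintegral_cst// mul0r.
have [||||dP PE] := @continuous_FTC1_closed R h (-1) x (x + 1).
- by rewrite ltrDl.
- apply: continuous_compact_integrable; first exact: segment_compact.
  exact: continuous_subspaceT.
- by rewrite (lt_le_trans _ x0)// ltrN10.
- exact: ch.
by apply: DeriveDef; [exact: dP|rewrite -derive1E PE].
Qed.

(** The two half-lines are treated separately, the negative one by reflection. *)
Lemma primitive_exists (R : realType) (g : R -> R) : continuous g ->
  exists2 P : R -> R, P 0 = 0 & forall t : R, is_derive t 1 P (g t).
Proof.
move=> cg.
have cmax : continuous (fun t : R => g (Num.max t 0) - g 0).
  move=> t; apply: cvgB; last exact: cvg_cst.
  apply: (@continuous_comp _ _ _ (fun t : R => Num.max t 0) g); last exact: cg.
  apply: (@continuous_max _ _ id (cst 0)); [exact: cvg_id|exact: cvg_cst].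
have cmin : continuous (fun t : R => g (- Num.max t 0) - g 0).
  move=> t; apply: cvgB; last exact: cvg_cst.
  apply: (@continuous_comp _ _ _ (fun t : R => - Num.max t 0) g); last exact: cg.
  apply: continuousN.
  apply: (@continuous_max _ _ id (cst 0)); [exact: cvg_id|exact: cvg_cst].
have [|P dP] := primitive_of_vanishing cmax.
  by move=> t t0; rewrite max_r// subrr.
have [|Q dQ] := primitive_of_vanishing cmin.
  by move=> t t0; rewrite max_r// oppr0 subrr.
pose S t := g 0 * t + (P t - Q (- t)).
exists (fun t => S t - S 0); first by rewrite subrr.
move=> t; have dPt := dP t.
have dQt : is_derive t 1 (fun t => Q (- t)) ((g (- Num.max (- t) 0) - g 0) * -1).
  by apply: (@is_derive1_comp _ Q -%R).
apply: is_derive_eq.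
rewrite /GRing.scale/= subr0.
have [t0|t0] := leP 0 t.
  by rewrite max_r ?oppr_le0// oppr0; ring.
by rewrite max_l ?oppr_ge0 ?ltW// opprK; ring.
Qed.

Lemma is_derive_expRM (R : realType) (c t : R) :
  is_derive t 1 (fun s => expR (c * s)) (c * expR (c * t)).
Proof.
have ? : is_derive t 1 (fun s => c * s) c.
  by apply: is_derive_eq; rewrite /GRing.scale/= mulr1.
by rewrite mulrC; apply: (@is_derive1_comp _ expR (fun s => c * s)).
Qed.

Lemma is_derive_continuous (R : realType) (u : R -> R) (t du : R) :
  is_derive t 1 u du -> {for t, continuous u}.
Proof. by case=> /derivable1_diffP/differentiable_continuous. Qed.

Lemma is_derive_comp_opp (R : realType) m n (A : R -> 'M[R]_(m, n)) (t : R)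
    (D : 'M[R]_(m, n)) :
  is_derive (- t) 1 A D -> is_derive t 1 (fun s => A (- s)) (- D).
Proof.
move=> /is_derive_mxP dA; apply/is_derive_mxP => i j; rewrite mxE -mulrN1.
by apply: (@is_derive1_comp _ (fun s => A s i j) -%R); exact: dA.
Qed.

(** Integrating a bound with the weight [expR (c * `|t|)] reproduces the weight and
   gains the factor [c]; a large [c] makes Picard iteration contract on the whole
   line. *)
Lemma exp_weight_bound (R : realType) (u du : R -> R) (A c : R) :
  0 <= A -> 0 < c -> u 0 = 0 ->
  (forall t : R, is_derive t 1 u (du t)) ->
  (forall t, `|du t| <= A * (c * expR (c * `|t|))) ->
  forall t, `|u t| <= A * expR (c * `|t|).
Proof.
move=> A0 c0; have half (v dv : R -> R) (t : R) : v 0 = 0 ->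
    (forall t : R, is_derive t 1 v (dv t)) ->
    (forall t, `|dv t| <= A * (c * expR (c * `|t|))) ->
    0 <= t -> v t <= A * expR (c * t).
  move=> v0 vE vle t0.
  pose w s := v s - A * expR (c * s).
  have dw (s : R) : is_derive s 1 w (dv s - A * (c * expR (c * s))).
    have ? := vE s; have ? := is_derive_expRM c s.
    by rewrite /w; apply: is_derive_eq; rewrite /GRing.scale/=; ring.
  have : w t <= w 0.
    apply: (@nonincreasing_of_derive _ _
              (fun s => dv s - A * (c * expR (c * s)))) => //.
      by apply: continuous_within => s _; exact: is_derive_continuous (dw s).
    move=> s /andP[s0 _]; split; first exact: dw.
    have := vle s; rewrite (ger0_norm (ltW s0)) subr_le0.
    exact/le_trans/ler_norm.
  rewrite /w v0 mulr0 expR0 mulr1 sub0r lerBlDl => /le_trans; apply.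
  by rewrite gerDl oppr_le0.
move=> u0 uE ule t.
wlog t0 : u du u0 uE ule t / 0 <= t.
  move=> wl; have [t0|/ltW t0] := leP 0 t; first exact: (wl u du).
  have := @wl (fun s => u (- s)) (fun s => - du (- s)) _ _ _ (- t).
  rewrite opprK normrN; apply; rewrite ?oppr0 ?oppr_ge0//.
    move=> s; rewrite -mulrN1.
    by apply: (@is_derive1_comp _ u -%R); exact: uE.
  by move=> s; rewrite normrN -(normrN s) ule.
rewrite (ger0_norm t0) ler_norml; apply/andP; split; last exact: (half u du).
rewrite lerNl; apply: (half (fun s => - u s) (fun s => - du s)) => //.
- by rewrite u0 oppr0.
- by move=> s; rewrite normrN.
Qed.

Lemma geometric_small (R : realType) (a e : R) : 0 < e ->
  exists k, a * 2^-1 ^+ k <= e.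
Proof.
move=> e0; have : (a * 2^-1 ^+ k) @[k --> \oo] --> a * 0.
  apply: cvgM; first exact: cvg_cst.
  by apply: cvg_expr; rewrite ger0_norm// invf_lt1// ltr1n.
rewrite mulr0 => /cvgrPdist_le /(_ _ e0)[k _ /(_ k (leqnn k)) ke].
by exists k; rewrite (le_trans _ ke)// sub0r normrN ler_norm.
Qed.

(** Completeness, for the Picard iterates and for those of the return map. *)
Lemma geometric_cvg (R : realType) m n (u : nat -> 'M[R]_(m, n)) (C : R) :
  (forall k, `|u k.+1 - u k| <= C * 2^-1 ^+ k) ->
  exists l, forall k, `|u k - l| <= 2 * C * 2^-1 ^+ k.
Proof.
move=> hu.
have C0 : 0 <= C by have := hu 0%N; rewrite expr0 mulr1; exact: le_trans.
have tail k p : `|u (k + p)%N - u k| <= 2 * C * 2^-1 ^+ k * (1 - 2^-1 ^+ p).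
  elim: p => [|p ih]; first by rewrite addn0 !subrr normr0 mulr0.
  rewrite addnS -(subrKA (u (k + p)%N)) (le_trans (ler_normD _ _))//.
  rewrite (le_trans (lerD (hu _) ih))// exprD exprS.
set x := 2^-1 ^+ k; set y := 2^-1 ^+ p.
by rewrite [leLHS](_ : _ = 2 * C * x * (1 - 2^-1 * y))//; field.
have tail' k q : (k <= q)%N -> `|u q - u k| <= 2 * C * 2^-1 ^+ k.
  move=> /subnKC <-; apply: (le_trans (tail _ _)).
  rewrite ler_piMr ?mulr_ge0 ?exprn_ge0 ?invr_ge0//.
have /cvg_ex[l ul] : cvg (u @ \oo).
  apply/cauchy_cvgP/cauchy_exP => e e0.
  have [k ke] : exists k, 2 * C * 2^-1 ^+ k <= e / 2.
    by apply: geometric_small; rewrite divr_gt0.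
  exists (u k); exists k => // q /= kq; rewrite -ball_normE/= distrC.
  rewrite (le_lt_trans (tail' _ _ kq))// (le_lt_trans ke)//=.
  by rewrite ltr_pdivrMr// ltr_pMr// ltr1n.
exists l => k; rewrite distrC.
have : `|u q - u k| @[q --> \oo] --> `|l - u k|.
  by apply: cvg_norm; apply: cvgB; [exact: ul|exact: cvg_cst].
by move=> /cvgr_to_le; apply; exists k => // q; exact: tail'.
Qed.

Lemma continuous_comp_lipschitz (R : realType) n (H : R -> 'cV[R]_n -> 'cV[R]_n)
    (L : R) (phi : R -> 'cV[R]_n) :
  0 < L -> (forall y, continuous (H^~ y)) ->
  (forall t y y', `|H t y' - H t y| <= L * `|y' - y|) ->
  continuous phi -> continuous (fun t => H t (phi t)).
Proof.
move=> L0 cH HL cphi t; apply/cvgrPdist_le => e e0.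
have e2 : 0 < e / 2 by rewrite divr_gt0.
have eL : 0 < e / 2 / L by rewrite divr_gt0.
move/cvgrPdist_le : (cphi t) => /(_ _ eL) h1.
move/cvgrPdist_le : (cH (phi t) t) => /(_ _ e2) h2.
near=> s; rewrite -(subrKA (H s (phi t))) (splitr e).
rewrite (le_trans (ler_normD _ _))// lerD//; first by near: s.
rewrite (le_trans (HL _ _ _))// mulrC -ler_pdivlMr//.
by near: s.
Unshelve. all: by end_near. Qed.

(** Picard iteration, run globally: in the weighted norm with weight
   [expR (- 2 * L * `|t|)] each iteration halves the distance of two curves. *)
Theorem picard (R : realType) n (H : R -> 'cV[R]_n -> 'cV[R]_n) (L B : R)
    (x0 : 'cV[R]_n) :
  0 < L -> (forall y, continuous (H^~ y)) ->
  (forall t y y', `|H t y' - H t y| <= L * `|y' - y|) ->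
  (forall t, `|H t x0| <= B) ->
  exists phi : R -> 'cV[R]_n,
    phi 0 = x0 /\ forall t : R, is_derive t 1 phi (H t (phi t)).
Proof.
move=> L0 cH HL HB; pose c := 2 * L; have c0 : 0 < c by rewrite mulr_gt0.
have B0 : 0 <= B by exact: le_trans (HB 0).
pose e (t : R) := expR (c * `|t|).
have e1 t : 1 <= e t.
  by rewrite (le_trans _ (expR_ge1Dx _))// lerDl mulr_ge0// ltW.
have prim (g : R -> R) : exists P : R -> R,
    continuous g -> P 0 = 0 /\ forall t : R, is_derive t 1 P (g t).
  have [cg|ncg] := pselect (continuous g); last by exists (fun=> 0).
  by have [P P0 dP] := primitive_exists cg; exists P.
have [I hI] := choice prim.
pose T (phi : R -> 'cV[R]_n) (t : R) : 'cV[R]_n :=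
  \col_i (x0 i 0 + I (fun s => H s (phi s) i 0) t).
have cHi (phi : R -> 'cV[R]_n) i :
    continuous phi -> continuous (fun s => H s (phi s) i 0).
  move=> cphi t.
  have := @continuous_comp_lipschitz _ _ _ _ _ L0 cH HL cphi.
  by move=> /(_ t)/cvg_mxP; exact.
have T0 (phi : R -> 'cV[R]_n) : continuous phi -> T phi 0 = x0.
  move=> cphi; apply/colP => i; rewrite mxE.
  by rewrite (hI _ (cHi phi i cphi)).1 addr0.
have dT (phi : R -> 'cV[R]_n) : continuous phi ->
    forall t : R, is_derive t 1 (T phi) (H t (phi t)).
  move=> cphi t; apply/is_derive_mxP => i j; rewrite ord1.
  under [X in is_derive _ _ X _]eq_fun do rewrite mxE.
  have ? := (hI _ (cHi phi i cphi)).2 t.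
  rewrite -[H t _ _ _]add0r.
  exact: (@is_deriveD _ _ _ (cst (x0 i 0)) (I (fun s => H s (phi s) i 0))).
have cT (phi : R -> 'cV[R]_n) : continuous phi -> continuous (T phi).
  by move=> cphi t; exact: derivable_continuous_mx (dT _ cphi t).
have half (phi psi : R -> 'cV[R]_n) (D : R) :
    continuous phi -> continuous psi -> 0 <= D ->
    (forall t, `|psi t - phi t| <= D * e t) ->
    forall t, `|T psi t - T phi t| <= D / 2 * e t.
  move=> cphi cpsi D0 hD t.
  apply: norm_le_coord; first by rewrite mulr_ge0 ?divr_ge0// expR_ge0.
  move=> i j; pose u s := (T psi s - T phi s) i j.
  pose du s := (H s (psi s) - H s (phi s)) i j.
  apply: (@exp_weight_bound _ u du) => //; first by rewrite divr_ge0.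
  - by rewrite /u !T0// subrr mxE.
  - move=> s; have ? := dT _ cphi s; have ? := dT _ cpsi s.
    have : is_derive s 1 (T psi - T phi) (H s (psi s) - H s (phi s)).
      exact: is_deriveB.
    by move=> /is_derive_mxP/(_ i j).
  - move=> s; rewrite /du (le_trans (coord_le_norm _ _ _))//.
    rewrite (le_trans (HL _ _ _))// (le_trans (ler_pM _ _ (lexx L) (hD s)))//.
      exact: ltW.
    by apply: ler_of_eq; rewrite /e /c; field.
pose phi k := iter k T (cst x0).
have cphi k : continuous (phi k).
  by elim: k => [|k ih]; [exact: cst_continuous|exact: cT].
pose C := B / c; have C0 : 0 <= C by rewrite divr_ge0// ltW.
have step k t : `|phi k.+1 t - phi k t| <= (C * e t) * 2^-1 ^+ k.
  rewrite mulrAC; elim: k t => [|k ih] t.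
    rewrite mulr1; apply: norm_le_coord.
      by rewrite mulr_ge0// expR_ge0.
    move=> i j; apply: (@exp_weight_bound _
      (fun s => (phi 1%N s - phi 0%N s) i j) (fun s => H s x0 i j)) => //.
    - by rewrite /phi/= T0 ?subrr ?mxE//; exact: cst_continuous.
    - move=> s; have ? := dT _ (cphi 0%N) s.
      have : is_derive s 1 (phi 1%N - cst x0) (H s x0 - 0).
        exact: is_deriveB.
      by rewrite subr0 => /is_derive_mxP/(_ i j).
    - move=> s; rewrite (le_trans (coord_le_norm _ _ _))// (le_trans (HB s))//.
      by rewrite mulrA /C divfK ?gt_eqF// ler_peMr//; exact: e1.
  have := half _ _ _ (cphi k) (cphi k.+1) _ ih t.
  by rewrite exprSr mulrA; apply; rewrite mulr_ge0// exprn_ge0 ?invr_ge0.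
have lim_ex t : exists l, forall k, `|phi k t - l| <= 2 * (C * e t) * 2^-1 ^+ k.
  exact: (@geometric_cvg _ _ _ (fun k => phi k t)).
have [psi hpsi] := choice lim_ex.
have cpsi : continuous psi.
  move=> t; apply/cvgrPdist_le => d d0.
  pose b := 2 * (C * expR (c * (`|t| + 1))).
  have [k kd] : exists k, b * 2^-1 ^+ k <= d / 3.
    by apply: geometric_small; rewrite divr_gt0.
  have near_t (s : R) : `|s| <= `|t| + 1 -> `|phi k s - psi s| <= d / 3.
    move=> st; apply: (le_trans (hpsi s k)); apply: le_trans kd.
    rewrite ler_wpM2r ?exprn_ge0 ?invr_ge0// /b ler_wpM2l// ler_wpM2l//.
    by rewrite ler_expR ler_wpM2l// ltW.
  have d3 : 0 < d / 3 by rewrite divr_gt0.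
  move/cvgrPdist_le : (cphi k t) => /(_ _ d3) h.
  have h1 : \forall s \near t, `|t - s| <= 1.
    by apply/nbhs_ballP; exists 1 => //= s; rewrite -ball_normE => /ltW.
  near=> s.
  rewrite -(subrKA (phi k t)) -(subrKA (phi k s) (phi k t)).
  rewrite (le_trans (ler_normD _ _))//.
  rewrite [leRHS](_ : _ = d / 3 + (d / 3 + d / 3)); last by field.
  rewrite lerD//; first by rewrite distrC near_t// lerDl.
  rewrite (le_trans (ler_normD _ _))// lerD//; first by near: s.
  rewrite near_t// -lerBlDl (le_trans (lerB_dist _ _))// distrC; near: s.
exists psi.
have fixpt : T psi = psi.
  apply/funext => t; apply/eqP; rewrite -subr_eq0 -normr_le0.
  apply/ler_addgt0Pr => d d0; rewrite add0r.
  have [k kd] := geometric_small (2 * (C * e t)) d0.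
  apply: le_trans kd; rewrite -(subrKA (phi k.+1 t)) (le_trans (ler_normD _ _))//.
  have h1 := hpsi t k.+1.
  have h2 : `|T psi t - phi k.+1 t| <= (2 * C * 2^-1 ^+ k) / 2 * e t.
    have D0 : 0 <= 2 * C * 2^-1 ^+ k.
      by apply: mulr_ge0; [exact: mulr_ge0|rewrite exprn_ge0 ?invr_ge0].
    apply: (half (phi k) psi) => //.
    by move=> s; rewrite distrC (le_trans (hpsi s k))// mulrA mulrAC.
  apply: (le_trans (lerD h2 h1)); rewrite exprS.
  by apply: ler_of_eq; field.
by split; [rewrite -fixpt T0|move=> t; rewrite -{1}fixpt; exact: dT].
Unshelve. all: by end_near. Qed.

(** The square of the Euclidean norm: the sup norm of a curve is not
   differentiable. *)
Definition sqn (R : realType) n (v : 'cV[R]_n) : R := \sum_i v i 0 ^+ 2.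

Lemma sqn_ge0 (R : realType) n (v : 'cV[R]_n) : 0 <= sqn v.
Proof. by apply: sumr_ge0 => i _; exact: sqr_ge0. Qed.

Lemma coord_sqn (R : realType) n (v : 'cV[R]_n) i : v i 0 ^+ 2 <= sqn v.
Proof.
rewrite /sqn (bigD1 i)//= lerDl; apply: sumr_ge0 => j _; exact: sqr_ge0.
Qed.

Lemma norm_le_sqn (R : realType) n (v : 'cV[R]_n) (a : R) :
  0 <= a -> sqn v <= a ^+ 2 -> `|v| <= a.
Proof.
move=> a0 va; apply: norm_le_coord => // i j; rewrite ord1.
by rewrite -ler_sqr ?nnegrE// real_normK ?num_real// (le_trans (coord_sqn _ _)).
Qed.

Lemma sqr_norm_le_sqn (R : realType) n (v : 'cV[R]_n) : `|v| ^+ 2 <= sqn v.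
Proof.
have s0 := sqn_ge0 v; have r0 : 0 <= Num.sqrt (sqn v) by [].
rewrite -(sqr_sqrtr s0) ler_sqr ?nnegrE//; apply: norm_le_sqn => //.
by rewrite sqr_sqrtr.
Qed.

Lemma sqn_le_norm (R : realType) n (v : 'cV[R]_n) : sqn v <= n%:R * `|v| ^+ 2.
Proof.
apply: (@le_trans _ _ (\sum_(i < n) `|v| ^+ 2)); last first.
  by rewrite sumr_const card_ord mulr_natl.
apply: ler_sum => i _; rewrite -real_normK ?num_real//.
by rewrite ler_sqr ?nnegrE// coord_le_norm.
Qed.

Lemma is_derive_sqn (R : realType) n (z : R -> 'cV[R]_n) (t : R) (dz : 'cV[R]_n) :
  is_derive t 1 z dz ->
  is_derive t 1 (fun s => sqn (z s)) (\sum_i 2 * (z t i 0 * dz i 0)).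
Proof.
move=> /is_derive_mxP dzi; rewrite /sqn.
have h i : is_derive t 1 ((fun s => z s i 0) ^+ 2) (2 * (z t i 0 * dz i 0)).
  have ? := dzi i 0; apply: is_derive_eq.
  by rewrite /GRing.scale/= expr1; ring.
have := is_derive_sum h; rewrite (_ : \sum_i _ = fun s => \sum_i z s i 0 ^+ 2)//.
by apply/funext => s; rewrite fct_sumE.
Qed.

(** The bound is only needed while the curve is small, so that a vector field which
   is Lipschitz near one of two solutions separates them as well as a globally
   Lipschitz one. *)
Lemma gronwall_zero (R : realType) n (z dz : R -> 'cV[R]_n) (b L delta : R) :
  0 < delta -> 0 <= L -> z 0 = 0 ->
  (forall s : R, 0 <= s <= b -> is_derive s 1 z (dz s)) ->
  (forall s : R, 0 <= s <= b -> `|z s| < delta -> `|dz s| <= L * `|z s|) ->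
  forall s : R, 0 <= s <= b -> z s = 0.
Proof.
move=> d0 L0 z0 dzE hz s sb.
have b0 : 0 <= b by case/andP: sb => /le_trans; exact.
pose u s := sqn (z s); pose du s := \sum_i 2 * (z s i 0 * dz s i 0).
have u0 : u 0 = 0.
  by rewrite /u z0 /sqn big1// => i _; rewrite mxE expr0n.
have : u s <= u 0 * expR ((2 * n%:R * L) * s).
  apply: (@barrier_comparison _ u du b _ (delta ^+ 2)) => //.
  - by move=> r rb; exact/is_derive_sqn/dzE.
  - move=> r rb ur.
    have zr : `|z r| < delta.
      rewrite -ltr_sqr ?nnegrE// ?ltW//; exact: le_lt_trans (sqr_norm_le_sqn _) ur.
    apply: (@le_trans _ _ (\sum_(i < n) 2 * (L * u r))).
      apply: ler_sum => i _; rewrite ler_wpM2l// (le_trans (ler_norm _))// normrM.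
      apply: (@le_trans _ _ (`|z r| * (L * `|z r|))).
        apply: ler_pM => //; first exact: coord_le_norm.
        by rewrite (le_trans (coord_le_norm _ _ _))// hz.
      by rewrite mulrCA ler_wpM2l// -expr2 sqr_norm_le_sqn.
    by rewrite sumr_const card_ord -mulr_natl; apply: ler_of_eq; ring.
  - by move=> r _; rewrite u0 mul0r exprn_gt0.
rewrite u0 mul0r => us; apply/eqP; rewrite -normr_le0.
by apply: norm_le_sqn => //; rewrite expr0n.
Qed.

Lemma is_derive_comp_shift (R : realType) m n (A : R -> 'M[R]_(m, n)) (t s : R)
    (D : 'M[R]_(m, n)) :
  is_derive (t + s) 1 A D -> is_derive t 1 (fun r => A (r + s)) D.
Proof.
move=> /is_derive_mxP dA; apply/is_derive_mxP => i j; rewrite -[D i j]mulr1.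
have h := @is_derive_shift R t 1 s.
have d : is_derive (shift s t) 1 (fun r => A r i j) (D i j) by exact: dA.
exact: (@is_derive1_comp _ _ _ _ _ _ d h).
Qed.

Definition lipschitz_field (R : realType) n (F : 'cV[R]_n -> 'cV[R]_n) (L B : R) :=
  [/\ 0 < L, forall x y, `|F y - F x| <= L * `|y - x| & forall x, `|F x| <= B].

Definition is_flow (R : realType) n (F : 'cV[R]_n -> 'cV[R]_n)
    (Phi : R -> 'cV[R]_n -> 'cV[R]_n) :=
  (forall x, Phi 0 x = x) /\
  (forall x (t : R), is_derive t 1 (Phi^~ x) (F (Phi t x))).

Lemma flow_exists (R : realType) n (F : 'cV[R]_n -> 'cV[R]_n) (L B : R) :
  lipschitz_field F L B -> exists Phi, is_flow F Phi.
Proof.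
move=> [L0 FL FB].
have h x : exists phi : R -> 'cV[R]_n, phi 0 = x /\
    forall t : R, is_derive t 1 phi (F (phi t)).
  apply: (@picard _ _ (fun=> F) L B) => //.
  by move=> y; exact: cst_continuous.
have [Psi hPsi] := choice h.
by exists (fun t x => Psi x t); split=> x; [exact: (hPsi x).1|exact: (hPsi x).2].
Qed.

Lemma lipschitz_ode_unique (R : realType) n (F : 'cV[R]_n -> 'cV[R]_n) (L B : R)
    (phi psi : R -> 'cV[R]_n) :
  lipschitz_field F L B -> phi 0 = psi 0 ->
  (forall t : R, is_derive t 1 phi (F (phi t))) ->
  (forall t : R, is_derive t 1 psi (F (psi t))) -> phi =1 psi.
Proof.
move=> [L0 FL _] e0 dphi dpsi t.
(* Negative times are reduced to positive ones by reversing the field. *)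
wlog t0 : F FL phi psi e0 dphi dpsi t / 0 <= t.
  move=> wl; have [t0|/ltW t0] := leP 0 t; first exact: (wl F).
  rewrite -(opprK t).
  apply: (wl (fun x => - F x) _ (fun s => phi (- s)) (fun s => psi (- s))).
  - by move=> x y; rewrite -opprD normrN.
  - by rewrite oppr0.
  - by move=> s; exact: is_derive_comp_opp.
  - by move=> s; exact: is_derive_comp_opp.
  - by rewrite oppr_ge0.
apply/eqP; rewrite -subr_eq0; apply/eqP.
apply: (@gronwall_zero _ _ (phi - psi) (fun s => F (phi s) - F (psi s)) t L 1) => //.
- exact: ltW.
- by rewrite !fctE e0 subrr.
- by rewrite t0 lexx.
Qed.

Lemma flow_unique (R : realType) n (F : 'cV[R]_n -> 'cV[R]_n) (L B : R) Phi phi :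
  lipschitz_field F L B -> is_flow F Phi ->
  (forall t : R, is_derive t 1 phi (F (phi t))) ->
  forall t, phi t = Phi t (phi 0).
Proof.
move=> FL [Phi0 dPhi] dphi.
by apply: lipschitz_ode_unique FL _ dphi _ => //=; rewrite Phi0.
Qed.

Lemma flowD (R : realType) n (F : 'cV[R]_n -> 'cV[R]_n) (L B : R) Phi s t x :
  lipschitz_field F L B -> is_flow F Phi ->
  Phi (s + t) x = Phi s (Phi t x).
Proof.
move=> FL fPhi; have [Phi0 dPhi] := fPhi.
have d (r : R) : is_derive r 1 (fun s => Phi (s + t) x) (F (Phi (r + t) x)).
  exact: is_derive_comp_shift.
by have := flow_unique FL fPhi d s; rewrite add0r.
Qed.

(** * Matrix-valued functions *)

Lemma cvg_mulmx (R : realType) (T : Type) (F : set_system T) m n p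
    (A : T -> 'M[R]_(m, n)) (B : T -> 'M[R]_(n, p)) (C : 'M[R]_(m, n))
    (D : 'M[R]_(n, p)) {FF : Filter F} :
  A @ F --> C -> B @ F --> D -> A s *m B s @[s --> F] --> C *m D.
Proof.
move=> /cvg_mxP AC /cvg_mxP BD; apply/cvg_mxP => i j; rewrite mxE.
under eq_fun do rewrite mxE.
by apply: cvg_big => [|k _]; [exact: add_continuous|apply: cvgM].
Qed.

Lemma cvg_det (R : realType) (T : Type) (F : set_system T) n
    (A : T -> 'M[R]_n) (D : 'M[R]_n) {FF : Filter F} :
  A @ F --> D -> \det (A s) @[s --> F] --> \det D.
Proof.
move=> /cvg_mxP AD; rewrite /determinant.
apply: cvg_big => [|k _]; first exact: add_continuous.
apply: cvgM; first exact: cvg_cst.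
by apply: cvg_big => [|i _]; [exact: mul_continuous|exact: AD].
Qed.

Lemma cvg_invmx (R : realType) (T : Type) (F : set_system T) n
    (A : T -> 'M[R]_n) (D : 'M[R]_n) {FF : Filter F} :
  A @ F --> D -> D \in unitmx -> (\forall s \near F, A s \in unitmx) ->
  invmx (A s) @[s --> F] --> invmx D.
Proof.
move=> AD uD uA.
have detAD : \det (A s) @[s --> F] --> \det D by exact: cvg_det.
have h : (\det (A s))^-1 *: \adj (A s) @[s --> F] --> (\det D)^-1 *: \adj D.
  apply/cvg_mxP => i j; rewrite !mxE; under eq_fun do rewrite !mxE.
  apply: cvgM; first by apply: cvgV => //; rewrite -unitfE -?unitmxE.
  rewrite /cofactor; apply: cvgM; first exact: cvg_cst.
  apply: cvg_det; apply/cvg_mxP => k l; rewrite !mxE; under eq_fun do rewrite !mxE.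
  by move/cvg_mxP : AD; exact.
rewrite {2}/invmx uD; apply: cvg_trans h; apply: near_eq_cvg.
by apply: filterS uA => s uAs; rewrite /invmx uAs.
Qed.

Lemma is_derive_mulmx (R : realType) m n p (A : R -> 'M[R]_(m, n))
    (B : R -> 'M[R]_(n, p)) (t : R) C D :
  is_derive t 1 A C -> is_derive t 1 B D ->
  is_derive t 1 (fun s => A s *m B s) (C *m B t + A t *m D).
Proof.
move=> /is_derive_mxP dA /is_derive_mxP dB; apply/is_derive_mxP => i j.
have h k : is_derive t 1 ((fun s => A s i k) * (fun s => B s k j))
    (C i k * B t k j + A t i k * D k j).
  have ? := dA i k; have ? := dB k j.
  by apply: is_derive_eq; rewrite /GRing.scale/=; ring.
have := is_derive_sum h.
rewrite (_ : \sum_i _ = fun s => (A s *m B s) i j); last first.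
  by apply/funext => s; rewrite fct_sumE mxE.
by rewrite big_split !mxE.
Qed.

Lemma is_derive_trmx (R : realType) m n (A : R -> 'M[R]_(m, n)) (t : R) D :
  is_derive t 1 A D -> is_derive t 1 (fun s => (A s)^T) D^T.
Proof.
move=> /is_derive_mxP dA; apply/is_derive_mxP => i j; rewrite mxE.
by under [X in is_derive _ _ X _]eq_fun do rewrite mxE; exact: dA.
Qed.

Lemma is_derive_quotientP (R : realType) (V : normedModType R) (A : R -> V)
    (t : R) (D : V) :
  is_derive t 1 A D <-> h^-1 *: (A (h + t) - A t) @[h --> (0 : R)^'] --> D.
Proof.
have E : (fun h : R => h^-1 *: ((A \o shift t) (h *: 1) - A t)) =
    (fun h => h^-1 *: (A (h + t) - A t)).
  by apply/funext => h /=; rewrite [h%:A]mulr1.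
split.
  move=> [dA <-]; rewrite /derive E; move: dA; rewrite /derivable E.
  exact.
move=> AD; split; rewrite ?/derivable ?/derive E; last exact/cvg_lim.
by apply/cvg_ex; exists D.
Qed.

(** From [B' - B = - B' (A' - A) B] for the inverses [B] and [B'] of [A] and
   [A']. *)
Lemma is_derive_invmx (R : realType) n (A : R -> 'M[R]_n) (t : R) D :
  is_derive t 1 A D -> (\forall s \near t, A s \in unitmx) ->
  is_derive t 1 (fun s => invmx (A s)) (- (invmx (A t) *m D *m invmx (A t))).
Proof.
move=> dA uA; have uAt : A t \in unitmx by exact: nbhs_singleton uA.
have cA : {for t, continuous A} := derivable_continuous_mx dA.
have cB : {for t, continuous (fun s => invmx (A s))} by exact: cvg_invmx.
have shift0 : (h + t) @[h --> (0 : R)^'] --> t.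
  rewrite -[X in _ --> X]add0r; apply: cvgD; last exact: cvg_cst.
  exact: nbhs_dnbhs.
apply/is_derive_quotientP.
have q : - (invmx (A (h + t)) *m (h^-1 *: (A (h + t) - A t)) *m invmx (A t))
    @[h --> (0 : R)^'] --> - (invmx (A t) *m D *m invmx (A t)).
  apply: cvgN; apply: cvg_mulmx; last exact: cvg_cst.
  apply: cvg_mulmx; last exact/is_derive_quotientP.
  exact: (cvg_comp _ _ shift0 cB).
apply: cvg_trans q; apply: near_eq_cvg.
have : \forall h \near (0 : R)^', A (h + t) \in unitmx by exact: (shift0 _ uA).
apply: filterS => h uAh.
rewrite -scalemxAr -scalemxAl -scalerN; congr (_ *: _).
by rewrite mulmxBr mulmxBl mulVmx// mul1mx -mulmxA mulmxV// mulmx1 opprB.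
Qed.

Lemma norm_mulmx_le (R : realType) m n p (A : 'M[R]_(m, n)) (B : 'M[R]_(n, p)) :
  `|A *m B| <= n%:R * `|A| * `|B|.
Proof.
apply: norm_le_coord; first by rewrite !mulr_ge0.
move=> i j; rewrite mxE (le_trans (ler_norm_sum _ _ _))//.
apply: (@le_trans _ _ (\sum_(k < n) `|A| * `|B|)).
  by apply: ler_sum => k _; rewrite normrM ler_pM// coord_le_norm.
by rewrite sumr_const card_ord -[leLHS]mulr_natl mulrA.
Qed.

(** * Continuously differentiable fields near a compact set *)

Lemma is_derive_along (R : realType) (V W : normedModType R) (g : V -> W)
    (gamma : R -> V) (t : R) (d : V) :
  differentiable g (gamma t) -> is_derive t 1 gamma d ->
  is_derive t 1 (fun s => g (gamma s)) ('D_d g (gamma t)).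
Proof.
move=> dg [dgamma dE].
have diffgamma : differentiable gamma t by exact/derivable1_diffP.
have dc : differentiable (g \o gamma) t by exact: differentiable_comp.
apply: DeriveDef; first exact/derivable1_diffP.
by rewrite deriveE// diff_comp//= -!deriveE// dE.
Qed.

Lemma cV_sum_basis (R : realType) n (v : 'cV[R]_n) :
  v = \sum_j v j 0 *: basis_vec R j.
Proof.
apply/colP => i; rewrite summxE (bigD1 i)//= big1.
  by rewrite !mxE !eqxx mulr1 addr0.
by move=> j ji; rewrite !mxE eq_sym (negPf ji) mulr0.
Qed.

Lemma derive_basis (R : realType) n (W : normedModType R) (g : 'cV[R]_n -> W) x v :
  differentiable g x ->
  'D_v g x = \sum_j v j 0 *: 'D_(basis_vec R j) g x.
Proof.
move=> dg; rewrite deriveE// {1}(cV_sum_basis v) linear_sum.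
by apply: eq_bigr => j _; rewrite linearZ deriveE.
Qed.

Lemma derive_basis_coord (R : realType) m n (g : 'cV[R]_n -> 'cV[R]_m) x v i :
  differentiable g x ->
  'D_v g x i 0 = \sum_j v j 0 * 'D_(basis_vec R j) g x i 0.
Proof.
move=> dg; rewrite (derive_basis v dg) summxE.
by apply: eq_bigr => j _; rewrite mxE.
Qed.

Lemma derive_col_coord (R : realType) m n (g : 'cV[R]_n -> 'cV[R]_m) x v i :
  differentiable g x -> 'D_v (fun y => g y i 0) x = 'D_v g x i 0.
Proof.
by move=> dg; rewrite derive_mx ?mxE//; exact: diff_derivable.
Qed.

Lemma Jac_mulmx (R : realType) n (f : 'cV[R]_n -> 'cV[R]_n) x v :
  differentiable f x -> Jac f x *m v = 'D_v f x.
Proof.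
move=> df; rewrite (derive_basis v df); apply/colP => i; rewrite mxE summxE.
by apply: eq_bigr => j _; rewrite !mxE mulrC derive_col_coord.
Qed.

Lemma orbital_derivativeE (R : realType) n (f : 'cV[R]_n -> 'cV[R]_n)
    (G : 'cV[R]_n -> 'M[R]_n) x :
  differentiable G x -> orbital_derivative f G x = 'D_(f x) G x.
Proof.
move=> dG; rewrite (derive_basis (f x) dG); apply/matrixP => k l.
rewrite mxE summxE; apply: eq_bigr => j _.
by rewrite mxE derive_mx ?mxE//; exact: diff_derivable.
Qed.

Lemma is_derive_line (R : realType) (V : normedModType R) (y v : V) (s : R) :
  is_derive s 1 (fun r : R => y + r *: v) v.
Proof.
apply/is_derive_quotientP; apply: cvg_near_cst; near=> h.
have h0 : h != 0 by near: h; exact: nbhs_dnbhs_neq.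
by rewrite opprD addrACA subrr add0r -scalerBl addrK scalerA mulVf// scale1r.
Unshelve. all: by end_near. Qed.

(** By the mean value theorem along the segment from [y] to [y']. *)
Lemma C1_strict_near (R : realType) n (U : set 'cV[R]_n)
    (f : 'cV[R]_n -> 'cV[R]_n) x0 (e : R) :
  open U -> C1_on U f -> U x0 -> 0 < e ->
  exists2 eta, 0 < eta & forall x y y',
    `|x - x0| < eta -> `|y - x0| < eta -> `|y' - x0| < eta ->
    U y /\ `|f y' - f y - 'D_(y' - y) f x| <= e * `|y' - y|.
Proof.
move=> oU fC1 Ux0 e0.
pose d := e / n.+1%:R / 2; have d0 : 0 < d by rewrite !divr_gt0.
have nearD (j : 'I_n) : \forall x \near x0,
    `|'D_(basis_vec R j) f x0 - 'D_(basis_vec R j) f x| <= d.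
  by have [_ /(_ (basis_vec R j))/cvgrPdist_le/(_ _ d0)] := fC1 _ Ux0.
have nearU : \forall x \near x0, U x by exact: open_nbhs_nbhs.
have /nbhs_ballP[eta /= eta0 heta] : \forall x \near x0, U x /\
    forall j : 'I_n, `|'D_(basis_vec R j) f x0 - 'D_(basis_vec R j) f x| <= d.
  by apply: filterS2 nearU (filter_forall _ nearD).
have {}heta x : `|x - x0| < eta -> U x /\
    forall j : 'I_n, `|'D_(basis_vec R j) f x0 - 'D_(basis_vec R j) f x| <= d.
  by move=> xeta; apply: heta; rewrite -ball_normE/= distrC.
exists eta => // x y y' xe ye ye'; have [Uy _] := heta _ ye.
have [Ux Dx] := heta _ xe.
split=> //; apply: norm_le_coord; first by rewrite mulr_ge0// ltW.
move=> i j; rewrite ord1 => {j}; pose v := y' - y.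
pose g s := f (y + s *: v) i 0 - s * 'D_v f x i 0.
pose dg s := 'D_v f (y + s *: v) i 0 - 'D_v f x i 0.
have seg s : 0 <= s <= 1 -> `|y + s *: v - x0| < eta.
  move=> /andP[s0 s1].
  have -> : y + s *: v - x0 = (1 - s) *: (y - x0) + s *: (y' - x0).
    by rewrite /v !scalerBr !scalerBl !scale1r; apply/colP => k; rewrite !mxE; ring.
  rewrite (le_lt_trans (ler_normD _ _))// !normrZ (ger0_norm s0) ger0_norm ?subr_ge0//.
  have : Num.max `|y - x0| `|y' - x0| < eta by rewrite gt_max ye.
  apply: le_lt_trans; set m := Num.max _ _.
  have : `|y - x0| <= m by rewrite le_max lexx.
  have : `|y' - x0| <= m by rewrite le_max lexx orbT.
  by nra.
have dgE (s : R) : 0 <= s <= 1 -> is_derive s 1 g (dg s).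
  move=> s01; have [Us _] := heta _ (seg s s01).
  have dl := is_derive_line y v s.
  have /is_derive_mxP/(_ i 0) ? := is_derive_along (fC1 _ Us).1 dl.
  by rewrite /g /dg; apply: is_derive_eq; rewrite /GRing.scale/= mulr0 add0r mulr1.
have [||c c01 gc] := @MVT _ g dg 0 1 ltr01.
- move=> s s01; apply: dgE; rewrite in_itv/= in s01.
  by case/andP: s01 => /ltW -> /ltW ->.
- apply: continuous_within => s; rewrite /= in_itv/= => s01.
  exact: is_derive_continuous (dgE s s01).
have c01' : 0 <= c <= 1 by rewrite in_itv/= in c01; case/andP: c01 => /ltW -> /ltW ->.
have -> : (f y' - f y - 'D_(y' - y) f x) i 0 = dg c.
  have := gc; rewrite /g !scale1r scale0r addr0 mul0r mul1r subr0 subr0 mulr1 => <-.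
  by rewrite [y + v]addrC subrK !mxE; ring.
have [Uc Dc] := heta _ (seg c c01').
rewrite /dg; move: (y + c *: v) Uc Dc => z Uc Dc.
have Ez := derive_basis_coord v i (fC1 _ Uc).1.
have Ex := derive_basis_coord v i (fC1 _ Ux).1.
rewrite Ez Ex -sumrB; under eq_bigr do rewrite -mulrBr.
rewrite (le_trans (ler_norm_sum _ _ _))//.
apply: (@le_trans _ _ (\sum_(j < n) e / n.+1%:R * `|v|)).
  apply: ler_sum => j _; rewrite normrM mulrC.
  apply: ler_pM => //; last exact: coord_le_norm.
  have -> : e / n.+1%:R = d + d by rewrite /d; field.
  apply: (@le_trans _ _ `|'D_(basis_vec R j) f z - 'D_(basis_vec R j) f x|).
    have := coord_le_norm ('D_(basis_vec R j) f z - 'D_(basis_vec R j) f x) i 0.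
    by rewrite !mxE.
  rewrite -(subrKA ('D_(basis_vec R j) f x0)).
  apply: le_trans (ler_normD _ _) _; apply: lerD; last exact: Dx.
  by rewrite distrC; exact: Dc.
rewrite -mulr_suml ler_wpM2r// sumr_const card_ord -[leLHS]mulr_natr.
by rewrite mulrAC ler_pdivrMr// ler_pM2l// ler_nat.
Qed.

Lemma near_right_witness (R : realType) (P : R -> Prop) :
  (\forall r \near (0 : R)^'+, P r) -> exists2 r, 0 < r & P r.
Proof.
move=> hP; near ((0 : R)^'+) => r; exists r; near: r => //.
exact: nbhs_right_gt.
Unshelve. all: by end_near. Qed.

(** Local estimates on small balls become estimates at one scale on all of [K]. *)
Lemma compact_uniform_scale (R : realType) (V : normedModType R) (K : set V)
    (P : R -> V -> Prop) :
  compact K ->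
  (forall x0, K x0 -> exists2 eta, 0 < eta &
    forall x r, `|x - x0| < eta -> 0 < r < eta -> P r x) ->
  exists2 r, 0 < r & forall x, K x -> P r x.
Proof.
move=> /compact_near_coveringP cK hP; apply: near_right_witness.
apply: (cK R _ P) => x0 /hP[eta eta0 heta].
exists (ball x0 eta, [set r | 0 < r < eta]); last first.
  by move=> [x r] /= [+ r0]; rewrite -ball_normE/= distrC => xe; exact: heta.
split => /=; first exact: nbhsx_ballx.
near=> r; apply/andP; split; near: r; first exact: nbhs_right_gt.
exact: nbhs_right_lt.
Unshelve. all: by end_near. Qed.

Lemma C1_strict_compact (R : realType) n (U K : set 'cV[R]_n)
    (f : 'cV[R]_n -> 'cV[R]_n) (e : R) :
  open U -> C1_on U f -> K `<=` U -> compact K -> 0 < e ->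
  exists2 rho, 0 < rho & forall x, K x -> forall y y',
    `|y - x| < rho -> `|y' - x| < rho ->
    U y /\ `|f y' - f y - 'D_(y' - y) f x| <= e * `|y' - y|.
Proof.
move=> oU fC1 KU cK e0.
apply: (@compact_uniform_scale _ _ K (fun rho x => forall y y',
    `|y - x| < rho -> `|y' - x| < rho ->
    U y /\ `|f y' - f y - 'D_(y' - y) f x| <= e * `|y' - y|)) => // x0 /KU Ux0.
have [eta eta0 h] := C1_strict_near oU fC1 Ux0 e0.
exists (eta / 2); first by rewrite divr_gt0.
move=> x r xe /andP[r0 re] y y' yx y'x.
have near_x0 z : `|z - x| < r -> `|z - x0| < eta.
  move=> zx; rewrite -(subrKA x) (le_lt_trans (ler_normD _ _))// (splitr eta).
  by rewrite ltrD// (lt_trans zx).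
by apply: h; [rewrite (lt_trans xe)// ltr_pdivrMr// ltr_pMr// ltr1n|exact: near_x0..].
Qed.

Lemma compact_norm_bound (R : realType) (T : topologicalType)
    (W : normedModType R) (K : set T) (g : T -> W) :
  compact K -> (forall x, K x -> {for x, continuous g}) ->
  exists2 B, 0 < B & forall x, K x -> `|g x| <= B.
Proof.
move=> cK cg.
have /compact_bounded[M [_ hM]] : compact (g @` K).
  by apply: continuous_compact => //; exact: continuous_within.
exists (Num.max 1 (M + 1)); first by rewrite lt_max ltr01.
move=> x Kx; apply: hM; last by exists x.
by rewrite lt_max ltrDl ltr01 orbT.
Qed.

(** * Extending the field to a globally Lipschitz one *)

Definition clamp (R : realType) (a b x : R) : R := Num.max a (Num.min b x).

Lemma clamp_bounds (R : realType) (a b x : R) : a <= b -> a <= clamp a b x <= b.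
Proof.
by move=> ab; rewrite /clamp le_max lexx/= ge_max ab ge_min lexx.
Qed.

Lemma clamp_id (R : realType) (a b x : R) : a <= x <= b -> clamp a b x = x.
Proof. by move=> /andP[ax xb]; rewrite /clamp min_r// max_r. Qed.

Lemma clamp_lipschitz (R : realType) (a b x y : R) : a <= b ->
  `|clamp a b y - clamp a b x| <= `|y - x|.
Proof.
move=> ab; rewrite /clamp.
wlog xy : x y / x <= y.
  move=> wl; have [/wl//|/ltW /wl] := leP x y.
  by rewrite distrC [leRHS]distrC.
rewrite [leRHS]ger0_norm ?subr_ge0//.
have h : forall u v : R, v <= u -> u - v <= y - x -> `|u - v| <= y - x.
  by move=> u v vu; rewrite ger0_norm ?subr_ge0.
apply: h.
  by rewrite ge_max !le_max lexx/= le_min !ge_min lexx/= xy !orbT.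
rewrite lerBlDr ge_max; apply/andP; split.
  by rewrite (@le_trans _ _ (Num.max a (Num.min b x)))// ?le_max ?lexx// lerDr subr_ge0.
rewrite (@le_trans _ _ (y - x + Num.min b x))//; last first.
  by rewrite lerD2l le_max lexx orbT.
by case: (leP b x) => bx; rewrite ge_min ?lerDr ?subr_ge0 ?xy// subrK lexx orbT.
Qed.

Definition set_dist (R : realType) n (K : set 'cV[R]_n) (y : 'cV[R]_n) : R :=
  inf [set `|y - x| | x in K].

Lemma set_dist_has_inf (R : realType) n (K : set 'cV[R]_n) y :
  K !=set0 -> has_inf [set `|y - x| | x in K].
Proof.
move=> [x Kx]; split; first by exists `|y - x|; exists x.
by exists 0 => _ [z _ <-].
Qed.

Lemma set_dist_le (R : realType) n (K : set 'cV[R]_n) x y :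
  K x -> set_dist K y <= `|y - x|.
Proof.
by move=> Kx; apply: ge_inf; [apply: (set_dist_has_inf y _).2; exists x|exists x].
Qed.

Lemma set_dist_lt (R : realType) n (K : set 'cV[R]_n) y r :
  K !=set0 -> set_dist K y < r -> exists2 x, K x & `|y - x| < r.
Proof.
move=> K0; rewrite -subr_gt0 => r0.
have [_ [x Kx <-] h] := inf_adherent r0 (set_dist_has_inf y K0).
by exists x => //; move: h; rewrite -/(set_dist K y) [ltRHS]addrC subrK.
Qed.

Lemma set_dist_lipschitz (R : realType) n (K : set 'cV[R]_n) y y' :
  K !=set0 -> `|set_dist K y' - set_dist K y| <= `|y' - y|.
Proof.
move=> K0; have half u v : set_dist K u - set_dist K v <= `|u - v|.
  rewrite lerBlDl -lerBlDr; apply: lb_le_inf => //.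
    by case: K0 => x Kx; exists `|v - x|; exists x.
  move=> _ [x Kx <-]; rewrite lerBlDr (le_trans (set_dist_le u Kx))//.
  by rewrite -(subrKA v u) addrC ler_normD.
by rewrite ler_norml half lerNl opprB distrC half.
Qed.

(** Multiplication by a Lipschitz cutoff that equals 1 within distance [rho / 4]
   of [K] and vanishes beyond distance [rho / 2]. *)
Lemma lipschitz_extension (R : realType) n (K : set 'cV[R]_n)
    (f : 'cV[R]_n -> 'cV[R]_n) (rho L B : R) :
  K !=set0 -> 0 < rho -> 0 < L -> 0 < B ->
  (forall x, K x -> forall y y', `|y - x| < rho -> `|y' - x| < rho ->
     `|f y| <= B /\ `|f y' - f y| <= L * `|y' - y|) ->
  exists F L', lipschitz_field F L' B /\
    forall x, K x -> forall y, `|y - x| < rho / 4 -> F y = f y.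
Proof.
move=> K0 rho0 L0 B0 hf.
pose chi y : R := clamp 0 1 (2 - 4 / rho * set_dist K y).
pose F y := chi y *: f y.
have rho4 : 0 < 4 / rho by rewrite divr_gt0.
have chi01 y : 0 <= chi y <= 1 by exact: clamp_bounds.
have chiL y y' : `|chi y' - chi y| <= 4 / rho * `|y' - y|.
  apply: (le_trans (clamp_lipschitz _ _ ler01)).
  rewrite (_ : _ - _ = 4 / rho * (set_dist K y - set_dist K y')); last by ring.
  rewrite normrM ger0_norm ?(ltW rho4)//.
  by rewrite ler_pM2l// distrC set_dist_lipschitz.
have chi0 y : rho / 2 <= set_dist K y -> chi y = 0.
  move=> dy; rewrite /chi /clamp max_l// ge_min; apply/orP; right.
  rewrite subr_le0; apply: (@le_trans _ _ (4 / rho * (rho / 2))).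
    by apply: ler_of_eq; field; rewrite gt_eqF.
  by rewrite ler_pM2l.
have FB y : `|F y| <= B.
  have [dy|/chi0 y0] := ltP (set_dist K y) (rho / 2); last first.
    by rewrite /F y0 scale0r normr0 ltW.
  have [x Kx yx] := set_dist_lt K0 dy.
  have yx' : `|y - x| < rho by rewrite (lt_trans yx)// ltr_pdivrMr// ltr_pMr// ltr1n.
  have [fB _] := hf x Kx y y yx' yx'.
  have /andP[c0 c1] := chi01 y.
  by rewrite /F normrZ ger0_norm// (le_trans _ fB)// ler_piMl.
pose L' := 4 / rho * B + L.
have L'0 : 0 < L' by rewrite addr_gt0// mulr_gt0.
have near y y' : set_dist K y < rho / 2 -> `|y' - y| < rho / 2 ->
    `|F y' - F y| <= L' * `|y' - y|.
  move=> dy yy'; have [x Kx yx] := set_dist_lt K0 dy.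
  have yx' : `|y - x| < rho by rewrite (lt_trans yx)// ltr_pdivrMr// ltr_pMr// ltr1n.
  have y'x : `|y' - x| < rho.
    by rewrite -(subrKA y) (le_lt_trans (ler_normD _ _))// (splitr rho) ltrD.
  have [fB _] := hf x Kx y y yx' yx'.
  have [_ fL] := hf x Kx y y' yx' y'x.
  have -> : F y' - F y = (chi y' - chi y) *: f y + chi y' *: (f y' - f y).
    by rewrite /F scalerBr scalerBl [RHS]addrC subrKA.
  rewrite (le_trans (ler_normD _ _))// !normrZ mulrDl lerD//.
    rewrite [leRHS]mulrAC; apply: ler_pM => //.
  have /andP[c0 c1] := chi01 y'.
  by rewrite ger0_norm// (le_trans _ fL)// ler_piMl.
exists F, L'; split; last first.
  move=> x Kx y yx; rewrite /F (_ : chi y = 1) ?scale1r//.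
  rewrite /chi /clamp min_l ?max_r//.
  rewrite lerBrDr -lerBrDl; apply: (@le_trans _ _ (4 / rho * (rho / 4))).
    rewrite ler_pM2l// (le_trans (set_dist_le y Kx))// ltW//.
  by apply: ler_of_eq; field; rewrite gt_eqF.
split=> // y y'.
have [far|close] := leP (rho / 2) `|y' - y|.
  apply: (@le_trans _ _ (B + B)).
    by rewrite (le_trans (ler_normB _ _))// lerD.
  apply: (@le_trans _ _ (4 / rho * B * (rho / 2))).
    by apply: ler_of_eq; field; rewrite gt_eqF.
  apply: ler_pM => //; last by rewrite lerDl ltW.
    by rewrite mulr_ge0 ?(ltW rho4) ?(ltW B0).
  by rewrite divr_ge0 ?(ltW rho0).
have [dy|/chi0 cy] := ltP (set_dist K y) (rho / 2); first exact: near.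
have [dy'|/chi0 cy'] := ltP (set_dist K y') (rho / 2).
  by rewrite distrC [`|y' - y|]distrC; apply: near => //; rewrite distrC.
by rewrite /F cy cy' !scale0r subrr normr0 mulr_ge0// ltW.
Qed.

(** * The infinitesimal contraction *)

Definition dot (R : realType) n (u v : 'cV[R]_n) : R := (u^T *m v) 0 0.

Lemma dotE (R : realType) n (u v : 'cV[R]_n) : dot u v = \sum_i u i 0 * v i 0.
Proof. by rewrite /dot mxE; apply: eq_bigr => i _; rewrite mxE. Qed.

Lemma dotC (R : realType) n (u v : 'cV[R]_n) : dot u v = dot v u.
Proof. by rewrite !dotE; apply: eq_bigr => i _; rewrite mulrC. Qed.

Lemma dotDr (R : realType) n (u v w : 'cV[R]_n) : dot u (v + w) = dot u v + dot u w.
Proof. by rewrite /dot mulmxDr mxE. Qed.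

Lemma dotZr (R : realType) n a (u v : 'cV[R]_n) : dot u (a *: v) = a * dot u v.
Proof. by rewrite /dot -scalemxAr mxE. Qed.

Lemma dotNr (R : realType) n (u v : 'cV[R]_n) : dot u (- v) = - dot u v.
Proof. by rewrite /dot mulmxN mxE. Qed.

Lemma dotBr (R : realType) n (u v w : 'cV[R]_n) : dot u (v - w) = dot u v - dot u w.
Proof. by rewrite dotDr dotNr. Qed.

Lemma dotDl (R : realType) n (u v w : 'cV[R]_n) : dot (v + w) u = dot v u + dot w u.
Proof. by rewrite !(dotC _ u) dotDr. Qed.

Lemma dotZl (R : realType) n a (u v : 'cV[R]_n) : dot (a *: u) v = a * dot u v.
Proof. by rewrite dotC dotZr dotC. Qed.

Lemma dotr0 (R : realType) n (u : 'cV[R]_n) : dot u 0 = 0.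
Proof. by rewrite /dot mulmx0 mxE. Qed.

Lemma dot_mulmxl (R : realType) m n (A : 'M[R]_(m, n)) u v :
  dot (A *m u) v = dot u (A^T *m v).
Proof. by rewrite /dot trmx_mul mulmxA. Qed.

Lemma dotvv (R : realType) n (u : 'cV[R]_n) : dot u u = sqn u.
Proof. by rewrite dotE /sqn; apply: eq_bigr => i _; rewrite expr2. Qed.

Lemma quad_dot (R : realType) n (A : 'M[R]_n) (w : 'cV[R]_n) :
  quad A w = dot w (A *m w).
Proof. by rewrite /quad /dot mulmxA. Qed.

Lemma dot_le_norm (R : realType) n (u v : 'cV[R]_n) :
  `|dot u v| <= n%:R * `|u| * `|v|.
Proof.
rewrite dotE (le_trans (ler_norm_sum _ _ _))//.
apply: (@le_trans _ _ (\sum_(i < n) `|u| * `|v|)).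
  by apply: ler_sum => i _; rewrite normrM ler_pM// coord_le_norm.
by rewrite sumr_const card_ord -[leLHS]mulr_natl mulrA.
Qed.

Lemma bilinear_le_norm (R : realType) n (A : 'M[R]_n) (u v : 'cV[R]_n) a :
  `|A| <= a -> `|dot u (A *m v)| <= n%:R ^+ 2 * a * (`|u| * `|v|).
Proof.
move=> Aa; apply: (le_trans (dot_le_norm _ _)).
apply: (@le_trans _ _ (n%:R * `|u| * (n%:R * a * `|v|))).
  rewrite ler_wpM2l ?mulr_ge0// (le_trans (norm_mulmx_le _ _))//.
  by rewrite ler_wpM2r// ler_wpM2l.
by apply: ler_of_eq; ring.
Qed.

(** Finsler's lemma, quantitatively: a form that is negative definite on the
   orthogonal complement of [f] becomes negative definite on the whole space once
   a large multiple of the square of [dot f] is subtracted.  The size of the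
   multiple comes from absorbing the cross terms of [w = u + s *: f]. *)
Lemma finsler (R : realType) n (Q : 'M[R]_n) (f : 'cV[R]_n) (c beta k : R) :
  0 < c -> f != 0 ->
  (forall u v, `|dot u (Q *m v)| <= beta * (`|u| * `|v|)) -> 0 <= beta ->
  (forall u, dot u f = 0 -> quad Q u <= - c * sqn u) ->
  2 * beta ^+ 2 / c + beta + c / 2 <= k * sqn f ->
  forall w, quad Q w - k * dot f w ^+ 2 <= - (c / 2) * sqn w.
Proof.
move=> c0 f0 hQ beta0 hc hk w.
have sf : 0 < sqn f.
  by apply: lt_le_trans (sqr_norm_le_sqn f); rewrite exprn_gt0// normr_gt0.
pose s := dot f w / sqn f.
have [v vE] : exists v, v = s *: f by exists (s *: f).
have [u [uf wE]] : exists u, dot u f = 0 /\ w = u + v.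
  exists (w - v); split; last by rewrite subrK.
  by rewrite vE dotC dotBr dotZr dotvv divfK ?gt_eqF// subrr.
have uv : dot u v = 0 by rewrite vE dotZr uf mulr0.
have fw : dot f w ^+ 2 = sqn f * sqn v.
  have -> : dot f w = s * sqn f by rewrite /s divfK// gt_eqF.
  by rewrite -(dotvv v) vE dotZl dotZr dotvv; ring.
have sw : sqn w = sqn u + sqn v.
  by rewrite -!dotvv wE dotDr !dotDl uv (dotC v u) uv; ring.
rewrite fw sw wE quad_dot mulmxDr dotDr !dotDl -!quad_dot.
have h1 := hc _ uf.
have h2 := le_trans (ler_norm _) (hQ u v).
have h3 := le_trans (ler_norm _) (hQ v u).
have h4 := le_trans (ler_norm _) (hQ v v); rewrite -quad_dot in h4.
have su := sqr_norm_le_sqn u; have sv := sqr_norm_le_sqn v.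
have h5 : k * sqn f * sqn v >= (2 * beta ^+ 2 / c + beta + c / 2) * sqn v.
  by rewrite ler_wpM2r// sqn_ge0.
have h6 : beta * `|u| * `|v| *+ 2 <= c / 2 * sqn u + 2 * beta ^+ 2 / c * sqn v.
  apply: (@le_trans _ _
    (c / 2 * `|u| ^+ 2 + 2 * beta ^+ 2 / c * `|v| ^+ 2)); last first.
    apply: lerD; rewrite ler_wpM2l// ?divr_ge0 ?mulr_ge0 ?exprn_ge0 ?(ltW c0)//.
  rewrite -subr_ge0 (_ : _ - _ = 2 / c * (c / 2 * `|u| - beta * `|v|) ^+ 2).
    by rewrite mulr_ge0 ?divr_ge0 ?(ltW c0)// sqr_ge0.
  by field; rewrite gt_eqF.
have h7 : beta * (`|v| * `|v|) <= beta * sqn v by rewrite ler_wpM2l// -expr2.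
by nra.
Qed.

Lemma quadZ (R : realType) n (A : 'M[R]_n) a (w : 'cV[R]_n) :
  quad A (a *: w) = a ^+ 2 * quad A w.
Proof. by rewrite !quad_dot -scalemxAr dotZl dotZr; ring. Qed.

(** By homogeneity, from the unit vectors over which the supremum is taken. *)
Lemma quad_le_lambda (R : realType) n (f : 'cV[R]_n -> 'cV[R]_n)
    (G : 'cV[R]_n -> 'M[R]_n) (x : 'cV[R]_n) (c : R) :
  lambda' f G x < - c -> forall u, dot u (f x) = 0 ->
  quad (Jac f x *m G x - 2^-1 *: orbital_derivative f G x) u <= - c * sqn u.
Proof.
rewrite /lambda'; set Q := _ - _ => hl u uf.
have [->|u0] := eqVneq u 0.
  by rewrite -dotvv quad_dot mulmx0 !dotr0 mulr0.
have su : 0 < sqn u.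
  by apply: lt_le_trans (sqr_norm_le_sqn u); rewrite exprn_gt0// normr_gt0.
pose r := Num.sqrt (sqn u); have r0 : 0 < r by rewrite sqrtr_gt0.
have rr : r ^+ 2 = sqn u by rewrite sqr_sqrtr// ltW.
have : quad Q (r^-1 *: u) <= - c.
  apply: ltW; apply: le_lt_trans hl; apply: ub_le_sup.
    exists (n%:R ^+ 2 * `|Q|) => _ [w [w1 _] <-].
    have sw : sqn w = 1.
      by rewrite -dotvv /dot w1 mxE.
    have nw : `|w| <= 1 by apply: norm_le_sqn; rewrite // sw expr1n.
    rewrite quad_dot (le_trans (ler_norm _))//.
    apply: (le_trans (bilinear_le_norm _ _ (lexx _))).
    rewrite ler_piMr ?mulr_ge0 ?exprn_ge0//.
    by rewrite mulr_ile1.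
  exists (r^-1 *: u) => //=; split; apply/matrixP => i j; rewrite !ord1.
    rewrite -[LHS]/(dot (r^-1 *: u) (r^-1 *: u)) dotZl dotZr dotvv -rr !mxE/=.
    by field; rewrite gt_eqF.
  by rewrite -[LHS]/(dot (r^-1 *: u) (f x)) dotZl uf mulr0 mxE.
by rewrite quadZ exprVn rr mulrC ler_pdivrMr.
Qed.

Definition posdef (R : realType) n (A : 'M[R]_n) :=
  A^T = A /\ forall w : 'cV[R]_n, w != 0 -> 0 < quad A w.

Lemma posdef_unitmx (R : realType) n (A : 'M[R]_n) : posdef A -> A \in unitmx.
Proof.
move=> [_ pA]; rewrite unitmxE unitfE; apply/det0P => -[v v0 vA].
have := pA v^T; rewrite /quad trmxK vA mul0mx mxE ltxx.
suff -> : v^T != 0 by move=> /(_ isT).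
by apply: contra v0 => /eqP/(congr1 trmx); rewrite trmxK trmx0 => ->.
Qed.

Lemma posdef_cauchy_schwarz (R : realType) n (A : 'M[R]_n) u w :
  posdef A -> dot u (A *m w) ^+ 2 <= quad A u * quad A w.
Proof.
move=> [sA pA]; have [->|w0] := eqVneq w 0.
  by rewrite !quad_dot mulmx0 !dotr0 mulr0 expr0n.
have pw := pA _ w0; set b := dot u (A *m w).
have bs : dot w (A *m u) = b by rewrite dotC dot_mulmxl sA.
have : 0 <= quad A (quad A w *: u - b *: w).
  have [->|/pA/ltW//] := eqVneq (quad A w *: u - b *: w) 0.
  by rewrite quad_dot mulmx0 dotr0.
have -> : quad A (quad A w *: u - b *: w) = quad A w * (quad A u * quad A w - b ^+ 2).
  rewrite -scaleNr quad_dot mulmxDr -!scalemxAr dotDr !dotDl !dotZl !dotZr bs -/b.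
  by rewrite -!quad_dot; ring.
by rewrite pmulr_rge0// subr_ge0.
Qed.

(** Cauchy-Schwarz against the basis vectors: the square of a coordinate [i] of
   [A *m w] is at most [A i i * quad A w].  This bounds the inverse metric from
   below without any spectral theory. *)
Lemma posdef_norm_le (R : realType) n (A : 'M[R]_n) w (g : R) :
  posdef A -> `|A| <= g -> `|A *m w| ^+ 2 <= g * quad A w.
Proof.
move=> pA Ag.
have q0 : 0 <= quad A w.
  have [->|/pA.2/ltW//] := eqVneq w 0.
  by rewrite quad_dot mulmx0 dotr0.
have g0 : 0 <= g by exact: le_trans Ag.
rewrite -(sqr_sqrtr (mulr_ge0 g0 q0)) ler_sqr ?nnegrE//.
apply: norm_le_coord => // i j; rewrite ord1.
rewrite -ler_sqr ?nnegrE// real_normK ?num_real// sqr_sqrtr ?mulr_ge0//.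
have dE (v : 'cV[R]_n) : dot (delta_mx i 0) v = v i 0.
  rewrite dotE (bigD1 i)//= big1 ?addr0 ?mxE ?eqxx ?mul1r// => k ki.
  by rewrite mxE (negPf ki) mul0r.
rewrite -dE (le_trans (posdef_cauchy_schwarz _ _ pA))// ler_wpM2r//.
rewrite quad_dot dE -colE mxE (le_trans (ler_norm _))//.
by rewrite (le_trans (coord_le_norm _ _ _)).
Qed.

(** The contraction rate at a point: up to an error that is small relative to
   [z], the left-hand side is twice the form bounded by [finsler], evaluated at
   the covector [w] with [z = G *m w]. *)
Lemma contraction_at_point (R : realType) n (J G D : 'M[R]_n) (f : 'cV[R]_n)
    (c k g eps : R) (z dz : 'cV[R]_n) :
  posdef G -> `|G| <= g -> 0 < g -> 0 <= eps ->
  (forall w, quad (J *m G - 2^-1 *: D) w - k * dot f w ^+ 2 <= - (c / 2) * sqn w) ->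
  2 * n%:R ^+ 2 * g * eps <= c / 2 -> 0 < c ->
  let w := invmx G *m z in
  `|dz - (J *m z - (k * dot f w) *: f)| <= eps * `|z| ->
  2 * dot w dz - dot w (D *m w) <= - (c / 2 / ((n%:R ^+ 2 + 1) * g)) * dot w z.
Proof.
move=> pG Gg g0 eps0 hF hc c0 w.
set E := dz - _ => hE.
have zE : z = G *m w by rewrite /w mulmxA mulmxV ?mul1mx// posdef_unitmx.
clearbody w.
have dzE : dz = E + (J *m z - (k * dot f w) *: f) by rewrite /E subrK.
move: E hE dzE => E hE dzE.
have -> : 2 * dot w dz - dot w (D *m w) =
    2 * (quad (J *m G - 2^-1 *: D) w - k * dot f w ^+ 2) + 2 * dot w E.
  rewrite {1}dzE !dotDr dotNr dotZr (dotC w f) quad_dot mulmxBl dotBr -scalemxAl dotZr.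
  by rewrite -mulmxA -zE; field.
have h1 := hF w; have sw := sqr_norm_le_sqn w; have sw0 := sqn_ge0 w.
have h2 : dot w E <= n%:R ^+ 2 * g * eps * sqn w.
  rewrite (le_trans (ler_norm _))// (le_trans (dot_le_norm _ _))//.
  apply: (@le_trans _ _ (n%:R * `|w| * (eps * (n%:R * g * `|w|)))).
    rewrite ler_wpM2l ?mulr_ge0// (le_trans hE)// ler_wpM2l// zE.
    by rewrite (le_trans (norm_mulmx_le _ _))// ler_wpM2r// ler_wpM2l.
  rewrite [leLHS](_ : _ = n%:R ^+ 2 * g * eps * `|w| ^+ 2); last by ring.
  by rewrite ler_wpM2l// !mulr_ge0 ?exprn_ge0// ltW.
have h3 : 2 * n%:R ^+ 2 * g * eps * sqn w <= c / 2 * sqn w by rewrite ler_wpM2r.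
apply: (@le_trans _ _ (- (c / 2) * sqn w)).
  by move: h1 h2 h3; set q := quad _ _; set d := dot w E; set a := k * _; nra.
rewrite !mulNr lerN2 -[leLHS]mulrA ler_wpM2l ?divr_ge0 ?(ltW c0)//.
have N0 : 0 < (n%:R ^+ 2 + 1) * g by rewrite mulr_gt0// ltr_wpDl// exprn_ge0.
rewrite mulrC ler_pdivrMr// zE (le_trans (ler_norm _))//.
apply: (le_trans (bilinear_le_norm _ _ Gg)).
rewrite [leRHS]mulrC; apply: ler_pM => //.
- by rewrite mulr_ge0 ?exprn_ge0// ltW.
- by rewrite ler_wpM2r ?(ltW g0)// lerDl.
Qed.

(** * The synchronising feedback *)

(** The component of [y - x] along [f x], in the metric [invmx (G x)], is damped: a
   point ahead of the reference point [x] is slowed down, a point behind it is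
   sped up. *)
Definition feedback (R : realType) n (k : R) (f : 'cV[R]_n -> 'cV[R]_n)
    (G : 'cV[R]_n -> 'M[R]_n) (x y : 'cV[R]_n) : R :=
  - (k * dot (f x) (invmx (G x) *m (y - x))).

Definition controlled (R : realType) n (k : R) (f : 'cV[R]_n -> 'cV[R]_n)
    (G : 'cV[R]_n -> 'M[R]_n) (x y : 'cV[R]_n) : 'cV[R]_n :=
  (1 + feedback k f G x y) *: f y.

(** [G x] is a metric on covectors, so displacements are measured by its inverse. *)
Definition lyap (R : realType) n (G : 'cV[R]_n -> 'M[R]_n) (x z : 'cV[R]_n) : R :=
  dot z (invmx (G x) *m z).

(** The derivative of [controlled k f G x] at the point [x] is [J - k f f^T M], with
   [J], [f] and [M = invmx G] taken at [x]; the strict differentiability of [f]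
   bounds the error for any two points near [x]. *)
Lemma controlled_linearization (R : realType) n (f : 'cV[R]_n -> 'cV[R]_n)
    (G : 'cV[R]_n -> 'M[R]_n) (J : 'M[R]_n) (x y y' : 'cV[R]_n)
    (k kap L rho eps : R) :
  (forall v, `|k * dot (f x) (invmx (G x) *m v)| <= kap * `|v|) ->
  `|f y' - f y| <= L * `|y' - y| -> `|f y - f x| <= L * `|y - x| ->
  `|f y' - f y - J *m (y' - y)| <= eps / 2 * `|y' - y| ->
  `|y - x| <= rho -> `|y' - x| <= rho -> 0 <= L -> 0 <= kap ->
  kap * L * rho <= eps / 4 ->
  `|controlled k f G x y' - controlled k f G x y -
    (J *m (y' - y) - (k * dot (f x) (invmx (G x) *m (y' - y))) *: f x)|
  <= eps * `|y' - y|.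
Proof.
move=> hk hL hLx hJ yx y'x L0 kap0 hr.
set z := y' - y; set b := k * dot _ _.
have ab : feedback k f G x y' = feedback k f G x y - b.
  rewrite /feedback /b -opprD -mulrDr -dotDr -mulmxDr; congr (- (_ * dot _ (_ *m _))).
  by rewrite [RHS]addrC subrKA.
have b_le : `|b| <= kap * `|z| by exact: hk.
have a_le : `|feedback k f G x y'| <= kap * rho.
  by rewrite /feedback normrN (le_trans (hk _))// ler_wpM2l.
have -> : controlled k f G x y' - controlled k f G x y - (J *m z - b *: f x) =
    (f y' - f y - J *m z) + feedback k f G x y' *: (f y' - f y)
      - b *: (f y - f x).
  by apply/colP => i; rewrite /controlled ab !mxE; ring.
rewrite (_ : eps * `|z| = eps / 2 * `|z| + eps / 4 * `|z| + eps / 4 * `|z|);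
  last by field.
have e1 : `|feedback k f G x y' *: (f y' - f y)| <= eps / 4 * `|z|.
  rewrite normrZ (le_trans (ler_pM _ _ a_le hL))//.
  by rewrite mulrA ler_wpM2r// mulrAC.
have e2 : `|b *: (f y - f x)| <= eps / 4 * `|z|.
  rewrite normrZ (le_trans (ler_pM _ _ b_le hLx))//.
  rewrite (@le_trans _ _ (kap * `|z| * (L * rho)))//.
    by rewrite ler_wpM2l ?mulr_ge0// ler_wpM2l.
  by rewrite [leLHS](_ : _ = kap * L * rho * `|z|) ?ler_wpM2r//; ring.
apply: (le_trans (ler_normB _ _)); apply: lerD => //.
by apply: (le_trans (ler_normD _ _)); exact: lerD.
Qed.

Section ContractionOnK.
Variables (R : realType) (n : nat) (U K : set 'cV[R]_n).
Variables (f : 'cV[R]_n -> 'cV[R]_n) (G : 'cV[R]_n -> 'M[R]_n) (c : R).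
Hypotheses (openU : open U) (f_C1 : C1_on U f) (G_metric : riemannian_metric U G).
Hypotheses (KU : K `<=` U) (K_compact : compact K).
Hypotheses (no_equilibrium : forall x, K x -> f x <> 0) (c_gt0 : 0 < c).
Hypothesis contraction : forall x, K x -> lambda' f G x < - c.

Lemma metric_posdef x : U x -> posdef (G x).
Proof. by move=> Ux; exact: G_metric.2. Qed.

Lemma C1_continuous (W : normedModType R) (g : 'cV[R]_n -> W) x :
  C1_on U g -> U x -> {for x, continuous g}.
Proof. by move=> gC1 Ux; exact/differentiable_continuous/(gC1 x Ux).1. Qed.

Lemma metric_inv_continuous x : U x -> {for x, continuous (fun y => invmx (G y))}.
Proof.
move=> Ux; have cG := C1_continuous G_metric.1 Ux.
have uG : \forall y \near x, G y \in unitmx.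
  have : \forall y \near x, U y by exact: open_nbhs_nbhs.
  by apply: filterS => y Uy; exact/posdef_unitmx/metric_posdef.
by apply: cvg_invmx cG _ uG; exact/posdef_unitmx/metric_posdef.
Qed.

Lemma Jac_bounded : exists2 b, 0 < b & forall x, K x -> `|Jac f x| <= b.
Proof.
have [|b b0 hb] := @compact_norm_bound R _ _ K
    (fun y => \matrix_(i, j) 'D_(basis_vec R j) f y i 0 : 'M[R]_n) K_compact.
  move=> x /KU Ux; apply/(@cvg_mxP _ _ (nbhs x) _ _ _ _ (nbhs_filter x)) => i j.
  rewrite mxE; under eq_fun do rewrite mxE.
  by have [_ /(_ (basis_vec R j))/cvg_mxP] := f_C1 Ux; exact.
exists b => // x Kx; rewrite (_ : Jac f x = \matrix_(i, j) 'D_(basis_vec R j) f x i 0).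
  exact: hb.
apply/matrixP => i j; rewrite !mxE derive_col_coord//.
exact: (f_C1 (KU Kx)).1.
Qed.

Lemma orbital_derivative_bounded :
  exists2 b, 0 < b & forall x, K x -> `|orbital_derivative f G x| <= b.
Proof.
have [|b b0 hb] := @compact_norm_bound R _ _ K
    (fun y => \sum_j f y j 0 *: 'D_(basis_vec R j) G y) K_compact.
  move=> x /KU Ux.
  apply: (cvg_big _ (F := nbhs x)) => [|j _]; first exact: add_continuous.
  apply: cvgZ; last exact: (G_metric.1 x Ux).2.
  by have /cvg_mxP := C1_continuous f_C1 Ux; exact.
exists b => // x Kx; have dG := (G_metric.1 x (KU Kx)).1.
by rewrite orbital_derivativeE// derive_basis//; exact: hb.
Qed.

Lemma speed_bounded_below : exists2 b, 0 < b & forall x, K x -> 1 <= b * sqn (f x).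
Proof.
have sf x : K x -> 0 < sqn (f x).
  move=> /no_equilibrium/eqP f0.
  by apply: lt_le_trans (sqr_norm_le_sqn _); rewrite exprn_gt0// normr_gt0.
have [|b b0 hb] := @compact_norm_bound R _ _ K
    (fun y => (sqn (f y))^-1 : R^o) K_compact.
  move=> x Kx; apply: (@cvgV _ _ (nbhs x)); first by rewrite gt_eqF// sf.
  apply: (cvg_big _ (F := nbhs x)) => [|j _]; first exact: add_continuous.
  under eq_fun do rewrite expr2; rewrite expr2.
  have /cvg_mxP/(_ j 0) h := C1_continuous f_C1 (KU Kx).
  exact: cvgM.
exists b => // x Kx; rewrite -ler_pdivrMr ?sf// div1r.
exact: le_trans (ler_norm _) (hb x Kx).
Qed.

(** The gain [k] is chosen from the bounds on [K], then the relative error [eps] of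
   the linearization, then the radius [rho].  The points [y] and [y'] are compared
   with each other and not only with [x]: this is what makes the return map of
   [periodic_point] a contraction. *)
Theorem contraction_data :
  exists k kap rho nu m,
    [/\ 0 < kap, 0 < rho, 0 < nu, 0 < m & forall x, K x ->
    [/\ forall v, `|k * dot (f x) (invmx (G x) *m v)| <= kap * `|v|,
        forall y, `|y - x| < rho -> `|feedback k f G x y| <= 2^-1,
        forall z, `|z| ^+ 2 <= m * lyap G x z /\ lyap G x z <= m * `|z| ^+ 2 &
        forall y y' w, `|y - x| < rho -> `|y' - x| < rho ->
          w = invmx (G x) *m (y' - y) ->
          2 * dot w (controlled k f G x y' - controlled k f G x y)
            - dot w (orbital_derivative f G x *m w)
          <= - nu * lyap G x (y' - y)]].
Proof.
have [bG bG0 hG] := compact_norm_bound K_compact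
  (fun x Kx => C1_continuous G_metric.1 (KU Kx)).
have [bM bM0 hM] := compact_norm_bound K_compact
  (fun x Kx => metric_inv_continuous (KU Kx)).
have [bf bf0 hf] := compact_norm_bound K_compact
  (fun x Kx => C1_continuous f_C1 (KU Kx)).
have [bJ bJ0 hJ] := Jac_bounded.
have [bD bD0 hD] := orbital_derivative_bounded.
have [bs bs0 hs] := speed_bounded_below.
have [N [N0 nN nN' NE]] : exists N : R,
    [/\ 0 < N, n%:R ^+ 2 <= N, n%:R <= N & n%:R ^+ 2 + 1 = N].
  exists (n%:R ^+ 2 + 1); split=> //; first by rewrite lerDl.
  by move: (n%:R : R) => a; have := sqr_ge0 (a - 2^-1); nra.
have [beta beta0 betaE] : exists2 beta, 0 < beta & N * (N * bJ * bG + bD) = beta.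
  by exists (N * (N * bJ * bG + bD)) => //; rewrite mulr_gt0// addr_gt0// !mulr_gt0.
have [k k0 hk0] : exists2 k, 0 < k & forall x, K x ->
    2 * beta ^+ 2 / c + beta + c / 2 <= k * sqn (f x).
  have b1 : 0 < 2 * beta ^+ 2 / c + beta + c / 2.
    by rewrite !addr_gt0// divr_gt0// mulr_gt0// exprn_gt0.
  exists ((2 * beta ^+ 2 / c + beta + c / 2) * bs); first by rewrite mulr_gt0.
  by move=> x Kx; rewrite -[leRHS]mulrA ler_peMr ?hs// ltW.
have [kap kap0 kapE] : exists2 kap, 0 < kap & k * (N * bf * bM) = kap.
  by exists (k * (N * bf * bM)) => //; rewrite !mulr_gt0.
have [eps eps0 epsE] : exists2 eps, 0 < eps & c / (4 * N * bG) = eps.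
  by exists (c / (4 * N * bG)) => //; rewrite divr_gt0// !mulr_gt0.
have eps20 : 0 < eps / 2 by rewrite divr_gt0.
have [rho0 rho00 hrho] := C1_strict_compact openU f_C1 KU K_compact eps20.
have [L L0 LE] : exists2 L, 0 < L & N * bJ + eps / 2 = L.
  by exists (N * bJ + eps / 2) => //; rewrite addr_gt0// mulr_gt0.
have [rho [rho_gt0 rho1 rho2 rho3]] : exists rho,
    [/\ 0 < rho, rho <= rho0, kap * rho <= 2^-1 & kap * L * rho <= eps / 4].
  exists (Num.min rho0 (Num.min (1 / (2 * kap)) (eps / (4 * kap * L)))).
  split.
  - by rewrite !lt_min rho00 !divr_gt0// !mulr_gt0.
  - by rewrite ge_min lexx.
  - rewrite mulrC -ler_pdivlMr//; apply: (@le_trans _ _ (1 / (2 * kap))).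
      by rewrite !ge_min lexx orbT.
    by apply: ler_of_eq; field; rewrite gt_eqF.
  - rewrite mulrC -ler_pdivlMr ?mulr_gt0//.
    apply: (@le_trans _ _ (eps / (4 * kap * L))).
      by rewrite !ge_min lexx !orbT.
    by apply: ler_of_eq; field; rewrite !gt_eqF.
have [nu nu0 nuE] : exists2 nu, 0 < nu & c / 2 / (N * bG) = nu.
  by exists (c / 2 / (N * bG)) => //; rewrite !divr_gt0// mulr_gt0.
exists k, kap, rho, nu, (bG + N * bM); split=> //; first by rewrite addr_gt0// mulr_gt0.
move=> x Kx; have pG := metric_posdef (KU Kx).
have hk v : `|k * dot (f x) (invmx (G x) *m v)| <= kap * `|v|.
  rewrite normrM (gtr0_norm k0) -kapE -mulrA ler_wpM2l ?(ltW k0)//.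
  apply: (le_trans (bilinear_le_norm _ _ (hM x Kx))).
  rewrite [leRHS](_ : _ = N * bM * (bf * `|v|)); last by ring.
  apply: ler_pM; rewrite ?mulr_ge0 ?exprn_ge0 ?(ltW bM0)//.
    by rewrite ler_wpM2r ?(ltW bM0).
  by rewrite ler_wpM2r ?hf.
split=> //.
- move=> y yx; rewrite /feedback normrN (le_trans (hk _))//.
  by apply: le_trans rho2; rewrite ler_pM2l// ltW.
- move=> z; have qz : quad (G x) (invmx (G x) *m z) = lyap G x z.
    rewrite quad_dot mulmxA mulmxV ?posdef_unitmx// mul1mx dotC//.
  have := posdef_norm_le (invmx (G x) *m z) pG (hG x Kx).
  rewrite mulmxA mulmxV ?posdef_unitmx// mul1mx qz => zl.
  have l0 : 0 <= lyap G x z.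
    have := le_trans (exprn_ge0 2 (normr_ge0 z)) zl; by rewrite pmulr_rge0.
  split; first by rewrite (le_trans zl)// mulrDl lerDl !mulr_ge0// ltW.
  rewrite /lyap (le_trans (ler_norm _))// (le_trans (bilinear_le_norm _ _ (hM x Kx)))//.
  rewrite -expr2 ler_wpM2r ?exprn_ge0//.
  by apply: (@le_trans _ _ (N * bM)); [rewrite ler_wpM2r// ltW|rewrite lerDr ltW].
- move=> y y' w yx y'x wE.
  have lip u u' : `|u - x| < rho -> `|u' - x| < rho -> `|f u' - f u| <= L * `|u' - u|.
    move=> ux u'x.
    have [_] := hrho x Kx u u' (lt_le_trans ux rho1) (lt_le_trans u'x rho1).
    rewrite -(Jac_mulmx _ (f_C1 (KU Kx)).1) => e1.
    rewrite -(subrK (Jac f x *m (u' - u)) (f u' - f u)) (le_trans (ler_normD _ _))//.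
    rewrite -LE mulrDl [leRHS]addrC lerD// (le_trans (norm_mulmx_le _ _))// ler_wpM2r//.
    by apply: ler_pM => //; exact: hJ.
  have [_ e1] := hrho x Kx y y' (lt_le_trans yx rho1) (lt_le_trans y'x rho1).
  rewrite -(Jac_mulmx _ (f_C1 (KU Kx)).1) in e1.
  have xx : `|x - x| < rho by rewrite subrr normr0.
  have e2 := controlled_linearization hk (lip _ _ yx y'x) (lip _ _ xx yx) e1
    (ltW yx) (ltW y'x) (ltW L0) (ltW kap0) rho3.
  rewrite /lyap [X in _ <= - nu * X]dotC wE.
  apply: le_trans (contraction_at_point pG (hG x Kx) bG0 (ltW eps0) _ _ c_gt0 e2) _.
  + apply: (@finsler _ _ _ _ _ beta) => //.
    * exact/eqP/no_equilibrium.
    * move=> u v; apply: (le_trans (bilinear_le_norm _ _ (lexx _))).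
      rewrite ler_wpM2r ?mulr_ge0// -betaE ler_pM ?exprn_ge0//.
      rewrite (le_trans (ler_normB _ _))// lerD//.
        rewrite (le_trans (norm_mulmx_le _ _))//.
        apply: ler_pM; rewrite ?mulr_ge0 ?hG//.
        by apply: ler_pM; rewrite ?hJ.
      rewrite normrZ gtr0_norm ?invr_gt0// (le_trans _ (hD x Kx))//.
      by rewrite ler_piMl// invf_le1// ler1n.
    * exact: ltW.
    * exact/quad_le_lambda/contraction.
    * exact: hk0.
  + apply: (@le_trans _ _ (2 * N * bG * eps)).
      by rewrite ler_wpM2r ?(ltW eps0)// ler_wpM2r ?(ltW bG0)// ler_wpM2l.
    by apply: ler_of_eq; rewrite -epsE; field; rewrite !gt_eqF.
  + by rewrite NE nuE.
Qed.

End ContractionOnK.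

(** * Synchronised trajectories *)

Lemma flow_speed (R : realType) n (F : 'cV[R]_n -> 'cV[R]_n) (L B : R) Phi x s t :
  lipschitz_field F L B -> is_flow F Phi ->
  `|Phi t x - Phi s x| <= B * `|t - s|.
Proof.
move=> [_ _ FB] [_ dPhi].
wlog st : s t / s <= t.
  by move=> wl; have [/wl//|/ltW/wl] := leP s t; rewrite distrC [`|s - t|]distrC.
have B0 : 0 <= B by exact: le_trans (FB 0).
apply: norm_le_coord => [|i j]; first by rewrite mulr_ge0.
have dc (r : R) : is_derive r 1 (fun r => Phi r x i j) (F (Phi r x) i j).
  by have /is_derive_mxP := dPhi x r.
have [r _ e] := @MVT_segment R (fun r => Phi r x i j) _ s t st
  (fun r _ => dc r) (continuous_within (fun r _ => is_derive_continuous (dc r))).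
rewrite !mxE e normrM ler_wpM2r//.
exact: le_trans (coord_le_norm _ _ _) (FB _).
Qed.

Lemma flow_continuous (R : realType) n (F : 'cV[R]_n -> 'cV[R]_n) Phi x :
  is_flow F Phi -> continuous (fun t : R => Phi t x : 'cV[R]_n).
Proof. by move=> [_ dPhi] t; exact: derivable_continuous_mx (dPhi x t). Qed.

(** The global flow moves with bounded speed, so that a trajectory that starts in
   [K] follows the original field for a time independent of the starting point. *)
Lemma flow_positively_invariant (R : realType) n (U K : set 'cV[R]_n)
    (f F : 'cV[R]_n -> 'cV[R]_n) (L B rho : R) Phi :
  0 < rho -> lipschitz_field F L B -> is_flow F Phi ->
  (forall x, K x -> forall y, `|y - x| < rho -> U y /\ F y = f y) ->
  positively_invariant U f K ->
  forall x t, K x -> 0 <= t -> K (Phi t x).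
Proof.
move=> rho0 FL fPhi hF pinv.
have B0 : 0 <= B by case: FL => _ _ /(_ 0); exact: le_trans.
have B1 : 0 < B + 1 by rewrite ltr_wpDl.
pose tau := rho / (B + 1); have tau0 : 0 < tau by rewrite divr_gt0.
have step x t : K x -> 0 <= t < tau -> K (Phi t x).
  move=> Kx /andP[t0 tt].
  pose I : set R := [set` `]- tau, tau[].
  have It s : I s -> `|s| < tau by rewrite /I/= in_itv/= ltr_norml.
  apply: (pinv I (Phi^~ x)) => //.
  - split.
    + exact: interval_open.
    + exact: interval_is_interval.
    + by rewrite /I/= in_itv/= oppr_lt0 tau0.
    + move=> s /It st; have [|Us FE] := hF x Kx (Phi s x).
        have := @flow_speed _ _ F L B Phi x 0 s FL fPhi.
        rewrite fPhi.1 subr0 => /le_lt_trans; apply.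
        apply: (@le_lt_trans _ _ ((B + 1) * `|s|)); first by rewrite ler_wpM2r// lerDl.
        by rewrite mulrC -ltr_pdivlMr.
      by split=> //; rewrite -FE; exact: fPhi.2.
  - by rewrite fPhi.1.
  - by rewrite /I/= in_itv/= tt (lt_le_trans _ t0)// oppr_lt0.
have tau20 : 0 < tau / 2 by rewrite divr_gt0.
have steps j x t : K x -> 0 <= t <= j%:R * (tau / 2) -> K (Phi t x).
  elim: j x t => [|j ih] x t Kx /andP[t0 tj].
    by apply: step => //; rewrite t0 (le_lt_trans tj)// mul0r.
  have [le|gt] := leP t (tau / 2).
    by apply: step => //; rewrite t0 (le_lt_trans le)// ltr_pdivrMr// ltr_pMr// ltr1n.
  rewrite -(subrK (tau / 2) t) (flowD _ _ _ FL fPhi); apply: ih.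
    by apply: step => //; rewrite ltW//= ltr_pdivrMr// ltr_pMr// ltr1n.
  by rewrite subr_ge0 ltW//= lerBlDr (le_trans tj)// -natr1 mulrDl mul1r.
move=> x t Kx t0; apply: (steps (Num.bound (t / (tau / 2)))) => //.
rewrite t0/= -ler_pdivrMr// ltW//.
by apply: le_lt_trans (archi_boundP _) => //; rewrite divr_ge0// ltW.
Qed.

(** Near the reference point the clamp changes nothing.  It keeps the clock between
   half and three halves of its normal speed and the equation of the clock globally
   Lipschitz. *)
Definition time_rate (R : realType) n k (f : 'cV[R]_n -> 'cV[R]_n)
    (G : 'cV[R]_n -> 'M[R]_n) (x y : 'cV[R]_n) : R :=
  1 + clamp (- 2^-1) 2^-1 (feedback k f G x y).

(** [theta] is the clock with which the trajectory of [y] has to be run so as to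
   stay abreast of the trajectory of [x]. *)
Definition tracking (R : realType) n k (f : 'cV[R]_n -> 'cV[R]_n)
    (G : 'cV[R]_n -> 'M[R]_n) (Phi : R -> 'cV[R]_n -> 'cV[R]_n)
    (x y : 'cV[R]_n) (theta : R -> R) : Prop :=
  [/\ theta 0 = 0, continuous theta & forall t : R, 0 <= t ->
    is_derive t 1 theta (time_rate k f G (Phi t x) (Phi (theta t) y))].

Lemma feedbackB (R : realType) n k (f : 'cV[R]_n -> 'cV[R]_n)
    (G : 'cV[R]_n -> 'M[R]_n) (x y y' : 'cV[R]_n) :
  feedback k f G x y' - feedback k f G x y =
  - (k * dot (f x) (invmx (G x) *m (y' - y))).
Proof.
rewrite /feedback -opprD -mulrBr -dotBr -mulmxBr; congr (- (_ * dot _ (_ *m _))).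
by rewrite opprB subrKA.
Qed.

Lemma feedback_self (R : realType) n k (f : 'cV[R]_n -> 'cV[R]_n)
    (G : 'cV[R]_n -> 'M[R]_n) (x : 'cV[R]_n) : feedback k f G x x = 0.
Proof. by rewrite /feedback subrr mulmx0 dotr0 mulr0 oppr0. Qed.

Lemma tracking_self (R : realType) n k (f : 'cV[R]_n -> 'cV[R]_n)
    (G : 'cV[R]_n -> 'M[R]_n) Phi (x : 'cV[R]_n) : tracking k f G Phi x x id.
Proof.
split=> [//|t|t _]; first exact: cvg_id.
rewrite /time_rate feedback_self clamp_id ?addr0.
  exact: is_derive_id.
by rewrite oppr_le0 invr_ge0 ler0n.
Qed.

Lemma tracking_clock (R : realType) n k (f : 'cV[R]_n -> 'cV[R]_n)
    (G : 'cV[R]_n -> 'M[R]_n) Phi (x y : 'cV[R]_n) theta t :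
  tracking k f G Phi x y theta -> 0 <= t -> t / 2 <= theta t <= 3 / 2 * t.
Proof.
move=> [th0 cth dth] t0.
have [||r rt e] := @MVT_segment R theta
    (fun r => time_rate k f G (Phi r x) (Phi (theta r) y)) 0 t t0.
- by move=> r; rewrite in_itv/= => /andP[r0 _]; apply: dth; exact: ltW.
- by apply: continuous_within => r _; exact: cth.
move: e; rewrite th0 !subr0 => ->; rewrite /time_rate.
have h : - 2^-1 <= (2^-1 : R) by rewrite (le_trans (y := 0))// ?oppr_le0 invr_ge0.
have /andP[] := clamp_bounds (feedback k f G (Phi r x) (Phi (theta r) y)) h.
move: (clamp _ _ _) => a ha hb.
apply/andP; split.
  by rewrite mulrC ler_wpM2r//; lra.
by rewrite ler_wpM2r//; lra.
Qed.

Section Tracking.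
Variables (R : realType) (n : nat) (U K : set 'cV[R]_n).
Variables (f F : 'cV[R]_n -> 'cV[R]_n) (G : 'cV[R]_n -> 'M[R]_n).
Variables (L B k kap rho nu m : R) (Phi : R -> 'cV[R]_n -> 'cV[R]_n).
Hypotheses (openU : open U) (f_C1 : C1_on U f) (G_metric : riemannian_metric U G).
Hypotheses (KU : K `<=` U) (F_lip : lipschitz_field F L B) (Phi_flow : is_flow F Phi).
Hypothesis Ff : forall x, K x -> forall y, `|y - x| < rho -> F y = f y.
Hypothesis PhiK : forall x t, K x -> 0 <= t -> K (Phi t x).
Hypotheses (kap_gt0 : 0 < kap) (rho_gt0 : 0 < rho) (nu_gt0 : 0 < nu) (m_gt0 : 0 < m).
Hypothesis gain_le : forall x, K x -> forall v,
  `|k * dot (f x) (invmx (G x) *m v)| <= kap * `|v|.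
Hypothesis feedback_le : forall x, K x -> forall y, `|y - x| < rho ->
  `|feedback k f G x y| <= 2^-1.
Hypothesis lyap_norm : forall x, K x -> forall z,
  `|z| ^+ 2 <= m * lyap G x z /\ lyap G x z <= m * `|z| ^+ 2.
Hypothesis lyap_decrease : forall x, K x -> forall y y' w,
  `|y - x| < rho -> `|y' - x| < rho -> w = invmx (G x) *m (y' - y) ->
  2 * dot w (controlled k f G x y' - controlled k f G x y)
    - dot w (orbital_derivative f G x *m w) <= - nu * lyap G x (y' - y).

Lemma feedback_continuous (X : R -> 'cV[R]_n) y t :
  {for t, continuous X} -> U (X t) ->
  {for t, continuous (fun s => feedback k f G (X s) y)}.
Proof.
move=> cX UX; have nF := nbhs_filter t.
have cf : f (X s) @[s --> t] --> f (X t).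
  by apply: (@continuous_comp _ _ _ X f); [exact: cX|exact: C1_continuous f_C1 UX].
have cM : invmx (G (X s)) @[s --> t] --> invmx (G (X t)).
  apply: (@continuous_comp _ _ _ X (fun z => invmx (G z))); first exact: cX.
  exact: metric_inv_continuous UX.
have cfT : (f (X s))^T @[s --> t] --> (f (X t))^T.
  apply/(@cvg_mxP _ _ (nbhs t)) => i j; rewrite mxE; under eq_fun do rewrite mxE.
  by move/cvg_mxP : cf; exact.
have cyX : y - X s @[s --> t] --> y - X t by apply: cvgB => //; exact: cvg_cst.
have cMyX := @cvg_mulmx _ _ _ _ _ _ _ _ _ _ nF cM cyX.
have /cvg_mxP/(_ 0 0) h := @cvg_mulmx _ _ _ _ _ _ _ _ _ _ nF cfT cMyX.
by apply: (@cvgN _ _ _ (nbhs t)); apply: (@cvgM _ _ (nbhs t)) => //; exact: cvg_cst.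
Qed.

Lemma tracking_exists x y : K x -> exists theta, tracking k f G Phi x y theta.
Proof.
(* For negative times the reference point stays at [x], as its trajectory may come
   from outside [K]. *)
move=> Kx; pose X (t : R) := Phi (Num.max t 0) x.
have KX t : K (X t) by apply: PhiK => //; rewrite le_max lexx orbT.
have cX : continuous X.
  move=> t; apply: (@continuous_comp _ _ _ (fun t : R => Num.max t 0) (Phi^~ x)).
    apply: (@continuous_max _ _ id (cst 0)); [exact: cvg_id|exact: cvg_cst].
  exact: (@flow_continuous _ _ F Phi x Phi_flow (Num.max t 0)).
pose H (t : R) (u : 'cV[R]_1) : 'cV[R]_1 :=
  const_mx (time_rate k f G (X t) (Phi (u 0 0) y)).
have h2 : - 2^-1 <= (2^-1 : R) by rewrite (le_trans (y := 0))// ?oppr_le0 invr_ge0.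
have B0 : 0 <= B by case: F_lip => _ _ /(_ 0); exact: le_trans.
have [|u t|t u u'|t|phi [phi0 dphi]] := @picard R 1 H (kap * (B + 1)) (3 / 2) 0.
- by rewrite mulr_gt0// ltr_wpDl.
- apply/(@cvg_mxP _ _ (nbhs t) _ _ _ _ (nbhs_filter t)) => i j; rewrite mxE.
  under eq_fun do rewrite mxE.
  apply: (@cvgD _ _ _ (nbhs t)); first exact: cvg_cst.
  have h : feedback k f G (X s) (Phi (u 0 0) y) @[s --> t] -->
      feedback k f G (X t) (Phi (u 0 0) y) 
    by exact: (@feedback_continuous X _ t (cX t) (KU (KX t))).
  apply/cvgrPdist_le => e e0; move/cvgrPdist_le : h => /(_ _ e0).
  by apply: filterS => s; apply: le_trans; exact: clamp_lipschitz.
- rewrite /H; apply: norm_le_coord.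
    by rewrite !mulr_ge0// ltW// ltr_wpDl.
  move=> i j; rewrite !mxE /time_rate.
  rewrite addrAC opprD addrA subrr add0r addrC (le_trans (clamp_lipschitz _ _ h2))//.
  rewrite feedbackB normrN (le_trans (gain_le (KX t) _))// -mulrA ler_pM2l//.
  rewrite (le_trans (flow_speed _ _ _ F_lip Phi_flow))//.
  apply: ler_pM => //; first by rewrite lerDl.
  by have := coord_le_norm (u' - u) 0 0; rewrite !mxE.
- apply: norm_le_coord => [|i j]; first by rewrite divr_ge0.
  rewrite mxE /time_rate.
  have /andP[] := clamp_bounds
    (feedback k f G (X t) (Phi ((0 : 'cV[R]_1) 0 0) y)) h2.
  move: (clamp _ _ _) => a ha hb; rewrite ger0_norm; lra.
exists (fun t => phi t 0 0); split.
- by rewrite phi0 mxE.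
- move=> t; have /is_derive_mxP/(_ 0 0) := dphi t; exact: is_derive_continuous.
- move=> t t0; have /is_derive_mxP/(_ 0 0) := dphi t.
  by rewrite /H mxE /X max_l.
Qed.

Lemma is_derive_clocked (y : 'cV[R]_n) (theta : R -> R) (t r : R) :
  is_derive t 1 theta r ->
  is_derive t 1 (fun s => Phi (theta s) y) (r *: F (Phi (theta t) y)).
Proof.
move=> dth; apply/is_derive_mxP => i j; rewrite mxE mulrC.
have /is_derive_mxP/(_ i j) d := Phi_flow.2 y (theta t).
exact: (@is_derive1_comp _ (fun s => Phi s y i j) theta).
Qed.

(** Along the trajectory the inverse metric [M] has the derivative [- M D M], with
   [D] the orbital derivative of [G]; in terms of [w = M z] all contributions become
   forms in [w]. *)
Lemma lyap_is_derive (X z : R -> 'cV[R]_n) (t : R) (dz : 'cV[R]_n) :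
  U (X t) -> is_derive t 1 X (f (X t)) -> is_derive t 1 z dz ->
  is_derive t 1 (fun s => lyap G (X s) (z s))
    (let w := invmx (G (X t)) *m z t in
     2 * dot w dz - dot w (orbital_derivative f G (X t) *m w)).
Proof.
move=> UX dX dzE; set w := invmx _ *m _; set D := orbital_derivative _ _ _.
have cX : {for t, continuous X} := derivable_continuous_mx dX.
have dG : is_derive t 1 (fun s => G (X s)) D.
  rewrite /D orbital_derivativeE; last exact: (G_metric.1 _ UX).1.
  by apply: is_derive_along => //; exact: (G_metric.1 _ UX).1.
have uG : \forall s \near t, G (X s) \in unitmx.
  have : \forall s \near t, U (X s) by apply: cX; exact: open_nbhs_nbhs.
  by apply: filterS => s Us; exact/posdef_unitmx/(metric_posdef G_metric).
have dM := is_derive_invmx dG uG.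
have /is_derive_mxP/(_ 0 0) := is_derive_mulmx (is_derive_trmx dzE)
  (is_derive_mulmx dM dzE).
set d := (X in is_derive _ _ _ X -> _) => h.
suff -> : 2 * dot w dz - dot w (D *m w) = d by [].
have sM : (invmx (G (X t)))^T = invmx (G (X t)).
  by rewrite trmx_inv (G_metric.2 _ UX).1.
have mv v : dot (z t) (invmx (G (X t)) *m v) = dot w v by rewrite /w dot_mulmxl sM.
have -> : d = dot dz w + dot (z t)
    (- (invmx (G (X t)) *m D *m invmx (G (X t))) *m z t + invmx (G (X t)) *m dz).
  by rewrite /d mxE.
by rewrite dotDr mulNmx dotNr -!mulmxA -/w !mv (dotC dz); ring.
Qed.

Lemma tracking_lyap_decrease x y y' theta theta' :
  K x -> tracking k f G Phi x y theta -> tracking k f G Phi x y' theta' ->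
  exists du : R -> R, forall t : R, 0 <= t ->
    is_derive t 1 (fun s => lyap G (Phi s x) (Phi (theta' s) y' - Phi (theta s) y))
      (du t) /\
    (`|Phi (theta t) y - Phi t x| < rho -> `|Phi (theta' t) y' - Phi t x| < rho ->
     du t <= - nu * lyap G (Phi t x) (Phi (theta' t) y' - Phi (theta t) y)).
Proof.
move=> Kx [_ _ dth] [_ _ dth'].
pose dY (y : 'cV[R]_n) (theta : R -> R) (t : R) :=
  time_rate k f G (Phi t x) (Phi (theta t) y) *: F (Phi (theta t) y).
have dYE t z vartheta : K (Phi t x) -> `|Phi (vartheta t) z - Phi t x| < rho ->
    dY z vartheta t = controlled k f G (Phi t x) (Phi (vartheta t) z).
  move=> Kt near; rewrite /dY /controlled (Ff Kt near) /time_rate clamp_id//.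
  by rewrite -ler_norml; exact: feedback_le.
eexists => t t0; have Kt := PhiK Kx t0.
have dX : is_derive t 1 (fun s => Phi s x) (f (Phi t x)).
  by rewrite -(Ff Kt) ?subrr ?normr0//; exact: Phi_flow.2.
have dz : is_derive t 1 (fun s => Phi (theta' s) y' - Phi (theta s) y)
    (dY y' theta' t - dY y theta t).
  have ? := is_derive_clocked y (dth t t0); have ? := is_derive_clocked y' (dth' t t0).
  exact: is_deriveB.
have := lyap_is_derive (KU Kt) dX dz; set d := (X in is_derive _ _ _ X) => hd.
split; first exact: hd.
move=> near near'; rewrite /d !dYE//.
exact: lyap_decrease.
Qed.

Lemma lyap_ge0 x z : K x -> 0 <= lyap G x z.
Proof.
move=> Kx; have [h _] := lyap_norm Kx z.
by have := le_trans (exprn_ge0 2 (normr_ge0 z)) h; rewrite pmulr_rge0.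
Qed.

Lemma rate_le1 s : 0 <= s -> expR (- nu * s) <= 1.
Proof. by move=> s0; rewrite expR_le1 mulNr oppr_le0 mulr_ge0// ltW. Qed.

(** Comparison with the reference trajectory, which tracks itself: as long as the
   tracking point is in the tube, [lyap] decreases, and so it cannot leave. *)
Lemma tracking_tube x y theta t :
  K x -> tracking k f G Phi x y theta -> m * `|y - x| < rho -> 0 <= t ->
  `|Phi (theta t) y - Phi t x| < rho.
Proof.
move=> Kx tr yx t0.
have [du hdu] := tracking_lyap_decrease Kx (tracking_self k f G Phi x) tr.
pose u s := lyap G (Phi s x) (Phi (theta s) y - Phi s x).
have near s : 0 <= s -> u s < rho ^+ 2 / m -> `|Phi (theta s) y - Phi s x| < rho.
  move=> s0 us; rewrite -ltr_sqr ?nnegrE// ?(ltW rho_gt0)//.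
  apply: le_lt_trans (lyap_norm (PhiK Kx s0) _).1 _.
  by rewrite mulrC -ltr_pdivlMr.
have u0 : u 0 < rho ^+ 2 / m.
  rewrite /u ltr_pdivlMr//; case: tr => -> _ _; rewrite !Phi_flow.1.
  apply: (@le_lt_trans _ _ ((m * `|y - x|) ^+ 2)).
    rewrite mulrC exprMn expr2 -mulrA ler_pM2l//.
    exact: (lyap_norm Kx _).2.
  by rewrite ltr_sqr ?nnegrE ?(ltW rho_gt0)// mulr_ge0// ltW.
have u00 : 0 <= u 0.
  by apply: lyap_ge0; apply: PhiK.
apply: (near t t0).
have : u t <= u 0 * expR (- nu * t).
  apply: (@barrier_comparison _ u du t _ (rho ^+ 2 / m)) => //.
  - by move=> s /andP[s0 _]; exact: (hdu s s0).1.
  - move=> s /andP[s0 _] us; apply: (hdu s s0).2; last exact: near.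
    by rewrite subrr normr0.
  - move=> s /andP[s0 _]; apply: le_lt_trans u0.
    by rewrite ler_piMr// rate_le1.
  - by rewrite t0 lexx.
move=> /le_lt_trans; apply; apply: le_lt_trans u0.
by rewrite ler_piMr// rate_le1.
Qed.

Theorem tracking_contraction x y y' theta theta' t :
  K x -> tracking k f G Phi x y theta -> tracking k f G Phi x y' theta' ->
  m * `|y - x| < rho -> m * `|y' - x| < rho -> 0 <= t ->
  `|Phi (theta' t) y' - Phi (theta t) y| <= m * expR (- (nu / 2) * t) * `|y' - y|.
Proof.
move=> Kx tr tr' yx y'x t0; have [du hdu] := tracking_lyap_decrease Kx tr tr'.
pose u s := lyap G (Phi s x) (Phi (theta' s) y' - Phi (theta s) y).
have u00 : 0 <= u 0 by apply: lyap_ge0; apply: PhiK.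
have ut : u t <= u 0 * expR (- nu * t).
  (* In the tube the decrease is unconditional, so any barrier above [u 0] will do. *)
  apply: (@barrier_comparison _ u du t _ (u 0 + 1)) => //.
  - by move=> s /andP[s0 _]; exact: (hdu s s0).1.
  - move=> s /andP[s0 _] _; apply: (hdu s s0).2; exact: tracking_tube.
  - move=> s /andP[s0 _]; apply: (@le_lt_trans _ _ (u 0)); last by rewrite ltrDl.
    by rewrite ler_piMr// rate_le1.
  - by rewrite t0 lexx.
have u0 : u 0 <= m * `|y' - y| ^+ 2.
  rewrite /u; case: tr => -> _ _; case: tr' => -> _ _; rewrite !Phi_flow.1.
  exact: (lyap_norm Kx _).2.
rewrite -ler_sqr ?nnegrE ?mulr_ge0 ?expR_ge0 ?(ltW m_gt0)//.
apply: (le_trans (lyap_norm (PhiK Kx t0) _).1).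
have -> : (m * expR (- (nu / 2) * t) * `|y' - y|) ^+ 2 =
    m * (m * `|y' - y| ^+ 2 * expR (- nu * t)).
  rewrite (_ : - nu * t = - (nu / 2) * t + - (nu / 2) * t); last by field.
  by rewrite expRD; ring.
by rewrite ler_pM2l// (le_trans ut)// ler_wpM2r// expR_ge0.
Qed.

End Tracking.

(** * Periodic orbits of a synchronised flow *)

Lemma expR_small (R : realType) (a e : R) : 0 < a -> 0 < e ->
  exists2 s0, 0 <= s0 & forall s, s0 <= s -> expR (- a * s) <= e.
Proof.
move=> a0 e0; exists (a * e)^-1; first by rewrite invr_ge0 mulr_ge0// ltW.
move=> s hs; have s0 : 0 < s by rewrite (lt_le_trans _ hs)// invr_gt0 mulr_gt0.
rewrite mulNr expRN -[leRHS]invrK lef_pV2 ?posrE ?expR_gt0 ?invr_gt0//.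
apply: le_trans (expR_ge1Dx _); apply: (@le_trans _ _ (a * s)); last by rewrite lerDr.
rewrite -ler_pdivrMl//; apply: le_trans hs.
by rewrite invfM.
Qed.

Lemma closed_approx (R : realType) n (S : set 'cV[R]_n) x :
  closed S -> (forall e, 0 < e -> exists2 z, S z & `|x - z| < e) -> S x.
Proof.
move=> cS hx; apply: cS => A /nbhs_ballP[e /= e0 eA].
have [z Sz xz] := hx e e0; exists z; split=> //.
by apply: eA; rewrite -ball_normE.
Qed.

Section SynchronisedFlow.
Variables (R : realType) (n : nat) (K : set 'cV[R]_n).
Variables (F : 'cV[R]_n -> 'cV[R]_n) (L B : R) (Phi : R -> 'cV[R]_n -> 'cV[R]_n).
Variables (Theta : 'cV[R]_n -> 'cV[R]_n -> R -> R) (r C mu : R).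
Hypotheses (F_lip : lipschitz_field F L B) (Phi_flow : is_flow F Phi).
Hypotheses (K_compact : compact K) (K_nonempty : K !=set0).
Hypothesis PhiK : forall x t, K x -> 0 <= t -> K (Phi t x).
Hypotheses (r_gt0 : 0 < r) (C_gt0 : 0 < C) (mu_gt0 : 0 < mu).
Hypothesis clock0 : forall x y, K x -> Theta x y 0 = 0.
Hypothesis clock_continuous : forall x y, K x -> continuous (Theta x y).
Hypothesis clock_rate : forall x y t, K x -> 0 <= t ->
  t / 2 <= Theta x y t <= 3 / 2 * t.
Hypothesis clock_self : forall x y t, K x -> `|y - x| < r -> 0 <= t ->
  `|Phi (Theta x y t) y - Phi t x| <= C * expR (- mu * t) * `|y - x|.
Hypothesis clock_contraction : forall x y y' t, K x ->
  `|y - x| < r -> `|y' - x| < r -> 0 <= t ->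
  `|Phi (Theta x y' t) y' - Phi (Theta x y t) y| <=
  C * expR (- mu * t) * `|y' - y|.

Let PhiD s t x : Phi (s + t) x = Phi s (Phi t x) := flowD s t x F_lip Phi_flow.

(** The position of [y] at time [s] is compared with the position of [x] at the time
   [t] when the clock of [y] shows [s]; the clock rate bounds [t] from below. *)
Lemma shadowing x y s : K x -> `|y - x| < r -> 0 <= s ->
  exists2 t, 2 / 3 * s <= t &
    `|Phi s y - Phi t x| <= C * expR (- (2 / 3 * mu) * s) * `|y - x|.
Proof.
move=> Kx yx s0.
have [|||t] := @IVT R (Theta x y) 0 (2 * s) s.
- by rewrite mulr_ge0.
- by apply: continuous_within => u _; exact: clock_continuous.
- have s20 : 0 <= 2 * s by rewrite mulr_ge0.
  have /andP[h _] := clock_rate y Kx s20.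
  rewrite clock0//; apply/andP; split; first by rewrite ge_min s0.
  by rewrite le_max (le_trans _ h) ?orbT// mulrAC divff// mul1r.
rewrite in_itv/= => /andP[t0 _] ts.
have /andP[_ h] := clock_rate y Kx t0; rewrite ts in h.
have st : 2 / 3 * s <= t by lra.
exists t => //; have := clock_self Kx yx t0; rewrite ts => /le_trans; apply.
rewrite ler_wpM2r// ler_pM2l// ler_expR !mulNr lerN2.
by have := ler_wpM2l (ltW mu_gt0) st; lra.
Qed.

(** Two visits of one trajectory near a cluster point of it. *)
Lemma recurrence (e T0 : R) : 0 < e -> 0 < T0 ->
  exists x T, [/\ K x, T0 <= T & `|Phi T x - x| < e].
Proof.
move=> e0 T00; have [p Kp] := K_nonempty.
pose u (j : nat) := Phi (j%:R * T0) p.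
have Ku j : K (u j) by apply: PhiK => //; rewrite mulr_ge0// ltW.
have [|q [_ qu]] := K_compact (F := u @ \oo) _ _.
  by exists 0%N => // j _; exact: Ku.
have visit N : exists2 j, (N <= j)%N & `|u j - q| < e / 2.
  have hA : (u @ \oo) (u @` [set j | (N <= j)%N]) by exists N => // j Nj; exists j.
  have hB : nbhs q (ball q (e / 2)) by apply: nbhsx_ballx; rewrite divr_gt0.
  have [z [[j Nj <-]]] := qu _ _ hA hB; rewrite -ball_normE/= distrC => h.
  by exists j.
have [i _ iq] := visit 0%N; have [j ij jq] := visit i.+1.
exists (u i), ((j - i)%:R * T0); split=> //.
  by rewrite ler_peMl ?(ltW T00)// ler1n subn_gt0.
rewrite -PhiD -mulrDl -natrD subnK ?(ltnW ij)// -/(u j).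
by rewrite -(subrKA q) (le_lt_trans (ler_normD _ _))// (splitr e) ltrD// distrC.
Qed.

(** The return map [y |-> Phi (Theta x y T) y] contracts a ball around an almost
   recurrent point [x] into itself; a fixed point lies on a closed orbit. *)
Lemma periodic_point :
  exists x l tau, [/\ K x, `|l - x| < r, 0 < tau & Phi tau l = l].
Proof.
pose r' := r / 2; have r'0 : 0 < r' by rewrite divr_gt0.
have r'r : r' < r by rewrite ltr_pdivrMr// ltr_pMr// ltr1n.
have C2 : 0 < C^-1 / 2 by rewrite divr_gt0// invr_gt0.
have [s0 s00 hs0] := expR_small mu_gt0 C2.
have s1 : 0 < s0 + 1 by rewrite ltr_wpDl.
have [x [T [Kx s0T xT]]] := recurrence (divr_gt0 r'0 (ltr0n _ 2)) s1.
have T0 : 0 < T by exact: lt_le_trans s0T.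
have CT : C * expR (- mu * T) <= 2^-1.
  rewrite -ler_pdivlMl// hs0// (le_trans _ s0T)// lerDl//.
pose ret y := Phi (Theta x y T) y.
have ret_contr y y' : `|y - x| <= r' -> `|y' - x| <= r' ->
    `|ret y' - ret y| <= 2^-1 * `|y' - y|.
  move=> yx y'x; apply: (le_trans (clock_contraction Kx _ _ (ltW T0))).
  - exact: le_lt_trans r'r.
  - exact: le_lt_trans r'r.
  - by rewrite ler_wpM2r.
have ret_ball y : `|y - x| <= r' -> `|ret y - x| <= r'.
  move=> yx; rewrite -(subrKA (Phi T x)) (le_trans (ler_normD _ _))//.
  rewrite (splitr r') lerD//; last exact: ltW.
  rewrite (le_trans (clock_self Kx _ (ltW T0)))//; first exact: le_lt_trans r'r.
  by rewrite [leRHS]mulrC ler_pM// mulr_ge0 ?expR_ge0// ltW.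
pose u k := iter k ret x.
have ub k : `|u k - x| <= r'.
  by elim: k => [|k ih]; [rewrite subrr normr0 ltW|exact: ret_ball].
have [k|l hl] := @geometric_cvg R _ _ u `|u 1%N - u 0%N|.
  elim: k => [|k ih]; first by rewrite mulr1.
  apply: (le_trans (ret_contr _ _ (ub k) (ub k.+1))).
  by rewrite exprS mulrCA ler_wpM2l// invr_ge0.
have lx : `|l - x| <= r'.
  apply/ler_addgt0Pr => d d0.
  have [k kd] := geometric_small (2 * `|u 1%N - u 0%N|) d0.
  rewrite -(subrKA (u k)) (le_trans (ler_normD _ _))// addrC lerD//.
  by rewrite distrC (le_trans (hl k)).
exists x, l, (Theta x l T); split=> //; first exact: le_lt_trans r'r.
  by have /andP[h _] := clock_rate l Kx (ltW T0); rewrite (lt_le_trans _ h)// divr_gt0.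
apply/eqP; rewrite -subr_eq0 -normr_le0; apply/ler_addgt0Pr => d d0; rewrite add0r.
have [k kd] := geometric_small (2 * (2 * `|u 1%N - u 0%N|)) d0.
apply: le_trans kd; rewrite -/(ret l) -(subrKA (u k.+1)).
apply: (le_trans (ler_normD _ _)); rewrite -mulrA [leRHS]mulr_natl mulr2n.
apply: lerD.
  apply: (le_trans (ret_contr _ _ (ub k) lx)).
  apply: (@le_trans _ _ `|l - u k|); first by rewrite ler_piMl// invf_le1// ler1n.
  by rewrite distrC; exact: hl.
apply: (le_trans (hl k.+1)); rewrite exprS mulrCA ler_piMl//.
by rewrite invf_le1// ler1n.
Qed.

Let K_closed : closed K.
Proof. by apply: compact_closed => //; exact: norm_hausdorff. Qed.

Lemma flow_period l tau j : Phi tau l = l -> Phi (j%:R * tau) l = l.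
Proof.
move=> h; elim: j => [|j ih]; first by rewrite mul0r Phi_flow.1.
by rewrite -natr1 mulrDl mul1r PhiD h.
Qed.

Lemma large_multiple (tau s : R) : 0 < tau -> exists j : nat, s <= j%:R * tau.
Proof.
move=> tau0; exists (Num.bound (`|s| / tau)); rewrite -ler_pdivrMr//.
apply: (@le_trans _ _ (`|s| / tau)).
  by rewrite ler_wpM2r ?invr_ge0 ?(ltW tau0)// ler_norm.
by apply/ltW/archi_boundP; rewrite divr_ge0// ltW.
Qed.

Lemma exp_rate_small (e : R) : 0 < e ->
  exists2 s0, 0 <= s0 & forall s, s0 <= s -> C * expR (- (2 / 3 * mu) * s) * r < e.
Proof.
move=> e0; have mu3 : 0 < 2 / 3 * mu by rewrite mulr_gt0// divr_gt0.
have e1 : 0 < e / (C * r) / 2 by rewrite !divr_gt0// mulr_gt0.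
have [s0 s00 h] := expR_small mu3 e1; exists s0 => // s /h hs.
rewrite mulrAC -ltr_pdivlMl ?mulr_gt0// [ltRHS]mulrC; apply: le_lt_trans hs _.
by rewrite ltr_pdivrMr// ltr_pMr ?ltr1n// divr_gt0// mulr_gt0.
Qed.

(** A periodic trajectory that is shadowed by a trajectory in [K] has [K] at
   distance zero, as it comes back unchanged while the distance decays. *)
Lemma shadowed_periodic_point x l tau :
  K x -> `|l - x| < r -> 0 < tau -> Phi tau l = l -> K l.
Proof.
move=> Kx lx tau0 hl; apply: (closed_approx K_closed) => e e0.
have [s0 s00 hs0] := exp_rate_small e0.
have [j sj] := large_multiple s0 tau0.
have jt0 : 0 <= j%:R * tau by rewrite mulr_ge0// ltW.
have [t st ht] := shadowing Kx lx jt0; exists (Phi t x).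
  by apply: PhiK => //; apply: le_trans st; rewrite mulr_ge0.
rewrite flow_period// in ht; apply: le_lt_trans ht _.
apply: le_lt_trans (hs0 _ sj); rewrite ler_wpM2l ?mulr_ge0 ?expR_ge0 ?ltW//.
Qed.

Section Orbit.
Variables (l : 'cV[R]_n) (tau : R).
Hypotheses (Kl : K l) (tau_gt0 : 0 < tau) (l_period : Phi tau l = l).

Let orbit := range (Phi^~ l).

Lemma orbit_flow z t : orbit z -> orbit (Phi t z).
Proof. by move=> [s _ <-]; exists (t + s) => //; rewrite PhiD. Qed.

Lemma orbit_nonneg t : exists2 t', 0 <= t' & Phi t' l = Phi t l.
Proof.
have [j hj] := large_multiple (- t) tau_gt0; exists (t + j%:R * tau).
  by rewrite -lerBlDl sub0r.
by rewrite PhiD flow_period.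
Qed.

Lemma orbit_sub : orbit `<=` K.
Proof. by move=> _ [t _ <-]; have [t' t0 <-] := orbit_nonneg t; exact: PhiK. Qed.

Lemma orbit_compact : compact orbit.
Proof.
have -> : orbit = (Phi^~ l) @` [set` `[0, tau]].
  apply/seteqP; split=> [_ [t _ <-]|_ [t _ <-]]; last by exists t.
  have [t' t0 <-] := orbit_nonneg t.
  have := truncn_itv (divr_ge0 t0 (ltW tau_gt0)); set q := Num.truncn _.
  rewrite ler_pdivlMr// ltr_pdivrMr// -natr1 mulrDl mul1r => /andP[h1 h2].
  exists (t' - q%:R * tau).
    by rewrite /= in_itv/= subr_ge0 h1/= lerBlDl ltW.
  by rewrite -{1}(flow_period q l_period) -PhiD subrK.
apply: continuous_compact; last exact: segment_compact.
by apply: continuous_within => t _; exact: (@flow_continuous _ _ F Phi l Phi_flow t).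
Qed.

Lemma orbit_attraction z y s : orbit z -> `|y - z| < r -> 0 <= s ->
  exists2 z', orbit z' &
    `|Phi s y - z'| <= C * expR (- (2 / 3 * mu) * s) * `|y - z|.
Proof.
move=> oz yz s0; have [t _ h] := shadowing (orbit_sub oz) yz s0.
by exists (Phi t z) => //; exact: orbit_flow.
Qed.

Definition attracted (x : 'cV[R]_n) : Prop := forall e, 0 < e ->
  exists2 s0, 0 <= s0 & forall s, s0 <= s -> exists2 z, orbit z & `|Phi s x - z| < e.

Lemma attracted_near x y : K x -> attracted x -> `|y - x| < r -> attracted y.
Proof.
move=> Kx ax yx e e0; have e2 : 0 < e / 2 by rewrite divr_gt0.
have [s1 s10 h1] := ax _ e2; have [s2 s20 h2] := exp_rate_small e2.
(* The matching time [t] is at least two thirds of [s]. *)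
exists (s1 * 2 + s2); first by rewrite addr_ge0// mulr_ge0.
move=> s hs; have s0 : 0 <= s by apply: le_trans hs; rewrite addr_ge0// mulr_ge0.
have [t st ht] := shadowing Kx yx s0.
have s2s : s2 <= s by apply: le_trans hs; rewrite lerDr mulr_ge0.
have s1t : s1 <= t by lra.
have [z oz hz] := h1 _ s1t; exists z => //.
rewrite -(subrKA (Phi t x)) (le_lt_trans (ler_normD _ _))// (splitr e) ltrD//.
apply: le_lt_trans ht _; apply: le_lt_trans (h2 _ s2s).
by rewrite ler_wpM2l ?mulr_ge0 ?expR_ge0 ?ltW.
Qed.

(** The radius in [attracted_near] does not depend on the point, so the basin of the
   orbit and its complement are both open in [K]. *)
Lemma connected_attracted : connected K -> forall x, K x -> attracted x.
Proof.
move=> cK; pose A := [set x | K x /\ attracted x].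
suff <- : A = K by move=> x [].
have openU (P : set 'cV[R]_n) : open (\bigcup_(x in P) ball x r).
  by apply: bigcup_open => x _; exact: ball_open.
have ball_r (x y : 'cV[R]_n) : ball x r y -> `|y - x| < r.
  by rewrite -ball_normE/= distrC.
apply: cK.
- exists l; split=> // e e0; exists 0 => // s _; exists (Phi s l); first by exists s.
  by rewrite subrr normr0.
- exists (\bigcup_(x in A) ball x r) => //; apply/seteqP; split=> x.
    by move=> [Kx ax]; split=> //; exists x => //; exact: ballxx.
  by move=> [Kx [y [Ky ay] /ball_r yx]]; split=> //; exact: attracted_near ay yx.
- exists (~` \bigcup_(x in K `\` A) ball x r); first exact: open_closedC.
  apply/seteqP; split=> x.
    move=> [Kx ax]; split=> // -[y [Ky nAy] /ball_r xy]; apply: nAy; split=> //.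
    by apply: attracted_near ax _ => //; rewrite distrC.
  move=> [Kx nx]; apply: contrapT => nAx; apply: nx; exists x => //.
  exact: ballxx.
Qed.

(** A periodic trajectory in the basin comes back to its starting point at times when
   it is arbitrarily close to the orbit. *)
Lemma periodic_point_on_orbit p T : connected K -> K p -> 0 < T -> Phi T p = p ->
  orbit p.
Proof.
move=> cK Kp T0 hp; apply: closed_approx.
  by apply: compact_closed; [exact: norm_hausdorff|exact: orbit_compact].
move=> e e0; have [s0 _ h] := connected_attracted cK Kp e0.
have [j hj] := large_multiple s0 T0.
by have [z oz] := h _ hj; rewrite flow_period// => pz; exists z.
Qed.

Lemma orbit_eq p : orbit p -> range (Phi^~ p) = orbit.
Proof.
move=> [s _ <-]; apply/seteqP; split=> _ [t _ <-].
  by exists (t + s) => //; rewrite PhiD.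
by exists (t - s) => //; rewrite -PhiD subrK.
Qed.

End Orbit.
End SynchronisedFlow.

(** * Stability of an attracting orbit *)

Lemma euclidean_norm_le (R : realType) n (v : 'cV[R]_n) :
  euclidean_norm v <= n.+1%:R * `|v|.
Proof.
have h : 0 <= n.+1%:R * `|v| by rewrite mulr_ge0.
rewrite /euclidean_norm -[leRHS]ger0_norm// -sqrtr_sqr ler_wsqrtr//.
apply: (le_trans (sqn_le_norm v)); rewrite exprMn ler_wpM2r ?exprn_ge0//.
by rewrite -natrX ler_nat (leq_trans (leqnSn n))// leq_pmulr.
Qed.

Lemma dist_ge0 (R : realType) n (x : 'cV[R]_n) (A : set 'cV[R]_n) : 0 <= dist x A.
Proof.
rewrite /dist; have [->|A0] := eqVneq A set0; first by rewrite image_set0 inf0.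
apply: lb_le_inf.
  by have /set0P[z Az] := A0; exists (euclidean_norm (x - z)); exists z.
by move=> _ [z _ <-]; exact: sqrtr_ge0.
Qed.

Lemma dist_le (R : realType) n (x z : 'cV[R]_n) (A : set 'cV[R]_n) : A z ->
  dist x A <= n.+1%:R * `|x - z|.
Proof.
move=> Az; apply: le_trans (euclidean_norm_le _).
apply: ge_inf; last by exists z.
by exists 0 => _ [w _ <-]; exact: sqrtr_ge0.
Qed.

Section Stability.
Variables (R : realType) (n : nat) (U K : set 'cV[R]_n).
Variables (f F : 'cV[R]_n -> 'cV[R]_n) (L B rho : R) (Phi : R -> 'cV[R]_n -> 'cV[R]_n).
Hypotheses (F_lip : lipschitz_field F L B) (Phi_flow : is_flow F Phi).
Hypothesis rho_gt0 : 0 < rho.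
Hypothesis Ff : forall x, K x -> forall y, `|y - x| < rho -> U y /\ F y = f y.

(** Half of the radius [rho], within which [F] agrees with [f], is left as a margin
   for a solution that is not yet known to follow the flow. *)
Let tube y := forall s, 0 <= s -> exists2 z, K z & `|Phi s y - z| < rho / 2.

Lemma solution_follows_flow I phi t :
  solution U f I phi -> tube (phi 0) -> I t -> 0 <= t -> phi t = Phi t (phi 0).
Proof.
move=> [_ itvI I0 sol] tb It t0; have [L0 FL _] := F_lip.
apply/eqP; rewrite -subr_eq0; apply/eqP.
pose z s := phi s - Phi s (phi 0).
have rho2 : 0 < rho / 2 by rewrite divr_gt0.
apply: (@gronwall_zero _ _ z (fun s => f (phi s) - F (Phi s (phi 0))) t L
  (rho / 2)) => //.
- exact: ltW.
- by rewrite /z Phi_flow.1 subrr.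
- move=> s st; have [_ d1] := sol s (itvI _ _ I0 It _ st).
  by have d2 := Phi_flow.2 (phi 0) s; exact: is_deriveB.
- move=> s /andP[s0 _] zs; have [x Kx hx] := tb s s0.
  have [_ <-] : U (phi s) /\ F (phi s) = f (phi s).
    apply: (Ff Kx); rewrite -(subrKA (Phi s (phi 0))) (le_lt_trans (ler_normD _ _))//.
    by rewrite (splitr rho) ltrD.
  exact: FL.
- by rewrite t0 lexx.
Qed.

Lemma flow_is_solution y : tube y -> exists I phi,
  [/\ solution U f I phi, [set t | 0 <= t] `<=` I & phi 0 = y].
Proof.
move=> tb; have B0 : 0 <= B by case: F_lip => _ _ /(_ 0); exact: le_trans.
have B1 : 0 < B + 1 by rewrite ltr_wpDl.
pose e := rho / 2 / (B + 1); have e0 : 0 < e by rewrite !divr_gt0.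
exists [set` `]- e, +oo[], (Phi^~ y); split; last exact: Phi_flow.1.
  split.
  - exact: interval_open.
  - exact: interval_is_interval.
  - by rewrite /= in_itv/= andbT oppr_lt0.
  - move=> t; rewrite /= in_itv/= andbT => et.
    suff [z Kz hz] : exists2 z, K z & `|Phi t y - z| < rho.
      have [Ut <-] := Ff Kz hz; split=> //; exact: Phi_flow.2.
    have [t0|t0] := leP 0 t.
      have [z Kz hz] := tb t t0; exists z => //; apply: lt_trans hz _.
      by rewrite ltr_pdivrMr// ltr_pMr// ltr1n.
    (* The speed bound keeps the point near [K] for short negative times. *)
    have [z Kz hz] := tb 0 (lexx 0); exists z => //.
    rewrite -(subrKA (Phi 0 y)) (le_lt_trans (ler_normD _ _))// (splitr rho) ltrD//.
    apply: le_lt_trans (flow_speed y 0 t F_lip Phi_flow) _; rewrite subr0 ltr0_norm//.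
    apply: (@le_lt_trans _ _ ((B + 1) * - t)).
      by rewrite ler_wpM2r ?lerDl// oppr_ge0 ltW.
    by rewrite mulrC -ltr_pdivlMr// ltrNl.
by move=> t /= t0; rewrite in_itv/= andbT (lt_le_trans _ t0)// oppr_lt0.
Qed.

Variables (Omega : set 'cV[R]_n) (r C a : R).
Hypotheses (Omega_compact : compact Omega) (Omega_K : Omega `<=` K).
Hypotheses (r_gt0 : 0 < r) (C_gt0 : 0 < C) (a_gt0 : 0 < a).
Hypothesis attraction : forall z y s, Omega z -> `|y - z| < r -> 0 <= s ->
  exists2 z', Omega z' & `|Phi s y - z'| <= C * expR (- a * s) * `|y - z|.

Let near_Omega d := [set y | exists2 z, Omega z & `|y - z| < d].

Lemma near_Omega_nbhs d : 0 < d -> set_nbhs Omega (near_Omega d).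
Proof.
move=> d0 z oz; apply/nbhs_ballP; exists d => // y.
by rewrite -ball_normE/= distrC => yz; exists z.
Qed.

Lemma stays_near e : 0 < e -> exists2 d, 0 < d & forall y, near_Omega d y ->
  forall s, 0 <= s -> near_Omega e (Phi s y).
Proof.
move=> e0; exists (Num.min r (e / C)); first by rewrite lt_min r_gt0 divr_gt0.
move=> y [z oz]; rewrite lt_min => /andP[yr yC] s s0.
have [z' oz' hz'] := attraction oz yr s0; exists z' => //; apply: le_lt_trans hz' _.
rewrite ltr_pdivlMr// in yC; apply: le_lt_trans yC.
rewrite mulrC ler_wpM2l// ler_piMr ?(ltW C_gt0)//.
by rewrite expR_le1 mulNr oppr_le0 mulr_ge0// ltW.
Qed.

Lemma near_tube : exists2 d, 0 < d & near_Omega d `<=` tube.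
Proof.
have [d d0 hd] := stays_near (divr_gt0 rho_gt0 (ltr0n _ 2)).
exists d => // y yd s s0; have [z oz hz] := hd y yd s s0.
by exists z => //; exact: Omega_K.
Qed.

Lemma attracting_orbitally_stable : orbitally_stable U f Omega.
Proof.
move=> V hV.
have [e e0 he] : exists2 e, 0 < e & forall z, Omega z ->
    forall y, `|y - z| < e -> V y.
  apply: (@compact_uniform_scale _ _ Omega
    (fun e z => forall y, `|y - z| < e -> V y)) => //.
  move=> z0 /hV/nbhs_ballP[e /= e0 heV]; exists (e / 2); first by rewrite divr_gt0.
  move=> z s zz0 /andP[s0 se] y yz; apply: heV; rewrite -ball_normE/= distrC.
  rewrite -(subrKA z) (le_lt_trans (ler_normD _ _))// (splitr e) ltrD//.
  exact: lt_trans se.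
have [d1 d10 hd1] := stays_near e0; have [d2 d20 hd2] := near_tube.
have d0 : 0 < Num.min d1 d2 by rewrite lt_min d10.
exists (near_Omega (Num.min d1 d2)); first exact: near_Omega_nbhs.
move=> y [z oz]; rewrite lt_min => /andP[yd1 yd2].
have tb : tube y by apply: hd2; exists z.
split; first exact: flow_is_solution.
move=> I phi sol phi0 t It t0.
rewrite (solution_follows_flow sol _ It t0) ?phi0//.
have [|z' oz' hz'] := hd1 y _ t t0; first by exists z.
exact: he oz' _ hz'.
Qed.

Theorem attracting_exponentially_stable : exponentially_stable U f Omega.
Proof.
split; first exact: attracting_orbitally_stable.
have [d d0 hd] := near_tube; pose d' := Num.min d r.
have d'0 : 0 < d' by rewrite lt_min d0.
(* Half of the rate is given away to make the weighted distance tend to 0. *)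
exists (a / 2), (near_Omega d'); split; first by rewrite divr_gt0.
  exact: near_Omega_nbhs.
move=> I phi sol subI [z oz]; rewrite lt_min => /andP[zd zr].
have tb : tube (phi 0) by apply: hd; exists z.
have a2 : 0 < a / 2 by rewrite divr_gt0.
pose M := n.+1%:R * (C * r); have M0 : 0 < M by rewrite !mulr_gt0.
apply/cvgrPdist_le => e e0.
have [s0 s00 hs0] := expR_small a2 (divr_gt0 e0 M0).
near=> t; have st : s0 <= t by near: t; apply: nbhs_pinfty_ge; exact: num_real.
have t0 : 0 <= t by exact: le_trans st.
rewrite sub0r normrN ger0_norm ?mulr_ge0 ?dist_ge0 ?expR_ge0//.
rewrite (solution_follows_flow sol tb (subI _ t0) t0).
have [z' oz' hz'] := attraction oz zr t0.
apply: (@le_trans _ _ (M * expR (- a * t) * expR (a / 2 * t))).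
  rewrite ler_wpM2r ?expR_ge0// (le_trans (dist_le _ oz'))// /M -mulrA ler_wpM2l//.
  rewrite (le_trans hz')// [leRHS]mulrAC ler_wpM2l// ?mulr_ge0 ?expR_ge0//; exact: ltW.
rewrite -mulrA -expRD (_ : - a * t + a / 2 * t = - (a / 2) * t); last by field.
by rewrite mulrC -ler_pdivlMr// hs0.
Unshelve. all: by end_near. Qed.

End Stability.

(** * The closed orbit of a contracting field *)

Lemma C1_locally_lipschitz (R : realType) n (U K : set 'cV[R]_n)
    (f : 'cV[R]_n -> 'cV[R]_n) :
  open U -> C1_on U f -> K `<=` U -> compact K ->
  exists rho L B, [/\ 0 < rho, 0 < L, 0 < B & forall x, K x -> forall y y',
    `|y - x| < rho -> `|y' - x| < rho ->
    [/\ U y, `|f y| <= B & `|f y' - f y| <= L * `|y' - y|]].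
Proof.
move=> oU fC1 KU cK.
have [bf bf0 hf] := compact_norm_bound cK (fun x Kx => C1_continuous fC1 (KU x Kx)).
have [bJ bJ0 hJ] := Jac_bounded fC1 KU cK.
have [rho rho0 hrho] := C1_strict_compact oU fC1 KU cK (ltr01 : 0 < 1).
pose L := n%:R * bJ + 1.
have L0 : 0 < L by rewrite ltr_wpDl// mulr_ge0// ltW.
exists rho, L, (bf + L * rho); split=> //; first by rewrite addr_gt0// mulr_gt0.
move=> x Kx.
have lip y y' : `|y - x| < rho -> `|y' - x| < rho ->
    U y /\ `|f y' - f y| <= L * `|y' - y|.
  move=> yx y'x; have [Uy] := hrho x Kx y y' yx y'x.
  rewrite -(Jac_mulmx _ (fC1 _ (KU _ Kx)).1) => e1; split=> //.
  rewrite -(subrK (Jac f x *m (y' - y)) (f y' - f y)) (le_trans (ler_normD _ _))//.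
  rewrite /L mulrDl [leRHS]addrC lerD// (le_trans (norm_mulmx_le _ _))//.
  by rewrite ler_wpM2r// ler_wpM2l// hJ.
move=> y y' yx y'x; have [Uy h] := lip y y' yx y'x; split=> //.
have xx : `|x - x| < rho by rewrite subrr normr0.
have [_ h'] := lip x y xx yx.
rewrite -(subrK (f x) (f y)) (le_trans (ler_normD _ _))// addrC lerD ?hf//.
by apply: le_trans h' _; rewrite ler_wpM2l ?(ltW L0)// ltW.
Qed.

Theorem theorem7 (R : realType) (n : nat) (U K : set 'cV[R]_n)
    (f : 'cV[R]_n -> 'cV[R]_n) (G : 'cV[R]_n -> 'M[R]_n) (c' : R)
    (openU : open U) (f_C1 : C1_on U f) (G_metric : riemannian_metric U G)
    (KU : K `<=` U) (K_nonempty : K !=set0) (K_compact : compact K)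
    (K_connected : connected K) (K_invariant : positively_invariant U f K)
    (no_equilibrium : forall x, K x -> f x <> 0)
    (c'_gt0 : 0 < c')
    (contraction : forall x, K x -> lambda' f G x < - c') :
  exists Omega : set 'cV[R]_n,
    unique (fun O => periodic_orbit U f O /\ O `<=` K) Omega /\
    exponentially_stable U f Omega.
Proof.
have [rho1 [L1 [B [rho10 L10 B0 hloc]]]] :=
  C1_locally_lipschitz openU f_C1 KU K_compact.
have [|F [L [F_lip Ff1]]] :=
  @lipschitz_extension R n K f rho1 L1 B K_nonempty rho10 L10 B0.
  by move=> x Kx y y' yx y'x; have [] := hloc x Kx y y' yx y'x.
have [k [kap [rho2 [nu [m [kap0 rho20 nu0 m0 hdata]]]]]] :=
  contraction_data openU f_C1 G_metric KU K_compact no_equilibrium c'_gt0 contraction.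
have [rho [rho0 rho_le1 rho_le2]] : exists rho,
    [/\ 0 < rho, rho <= rho1 / 4 & rho <= rho2].
  exists (Num.min (rho1 / 4) rho2); rewrite lt_min rho20 divr_gt0// !ge_min !lexx orbT.
  by split.
have Ff x : K x -> forall y, `|y - x| < rho -> U y /\ F y = f y.
  move=> Kx y yx; have yx4 : `|y - x| < rho1 / 4 by exact: lt_le_trans rho_le1.
  have yx1 : `|y - x| < rho1.
    by apply: lt_trans yx4 _; rewrite ltr_pdivrMr// ltr_pMr// ltr1n.
  by split; [have [] := hloc x Kx y y yx1 yx1|exact: Ff1 Kx _ yx4].
have [Phi Phi_flow] := flow_exists F_lip.
have PhiK := flow_positively_invariant rho0 F_lip Phi_flow Ff K_invariant.
have FfK x : K x -> forall y, `|y - x| < rho -> F y = f y.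
  by move=> Kx y yx; have [] := Ff x Kx y yx.
have gain x (Kx : K x) v : `|k * dot (f x) (invmx (G x) *m v)| <= kap * `|v|.
  by have [] := hdata x Kx.
have fb x (Kx : K x) y (yx : `|y - x| < rho) : `|feedback k f G x y| <= 2^-1.
  by have [_ h _ _] := hdata x Kx; apply: h; exact: lt_le_trans rho_le2.
have lyapn x (Kx : K x) z :
    `|z| ^+ 2 <= m * lyap G x z /\ lyap G x z <= m * `|z| ^+ 2.
  by have [_ _ h _] := hdata x Kx.
have decr x (Kx : K x) y y' w : `|y - x| < rho -> `|y' - x| < rho ->
    w = invmx (G x) *m (y' - y) ->
    2 * dot w (controlled k f G x y' - controlled k f G x y)
      - dot w (orbital_derivative f G x *m w) <= - nu * lyap G x (y' - y).
  by have [_ _ _ h] := hdata x Kx => yx y'x; apply: h; exact: lt_le_trans rho_le2.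
have theta_ex (p : 'cV[R]_n * 'cV[R]_n) : exists theta : R -> R,
    K p.1 -> tracking k f G Phi p.1 p.2 theta.
  have [Kp|nKp] := pselect (K p.1); last by exists id.
  have [theta h] := tracking_exists openU f_C1 G_metric KU F_lip Phi_flow PhiK
    kap0 gain p.2 Kp.
  by exists theta.
have [Th hTh] := choice theta_ex; pose Theta x y := Th (x, y).
have tr x y : K x -> tracking k f G Phi x y (Theta x y) := hTh (x, y).
pose r := rho / m; have r0 : 0 < r by rewrite divr_gt0.
have r_small (x y : 'cV[R]_n) : `|y - x| < r -> m * `|y - x| < rho.
  by rewrite /r ltr_pdivlMr// mulrC.
have mu0 : 0 < nu / 2 by rewrite divr_gt0.
have contr x y y' t (Kx : K x) : `|y - x| < r -> `|y' - x| < r -> 0 <= t ->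
    `|Phi (Theta x y' t) y' - Phi (Theta x y t) y| <=
    m * expR (- (nu / 2) * t) * `|y' - y|.
  move=> yx y'x; exact: (tracking_contraction openU G_metric KU Phi_flow FfK PhiK
    rho0 nu0 m0 fb lyapn decr Kx (tr x y Kx) (tr x y' Kx)
    (r_small _ _ yx) (r_small _ _ y'x)).
have self x y t (Kx : K x) : `|y - x| < r -> 0 <= t ->
    `|Phi (Theta x y t) y - Phi t x| <= m * expR (- (nu / 2) * t) * `|y - x|.
  have xx : m * `|x - x| < rho by rewrite subrr normr0 mulr0.
  move=> yx; exact: (tracking_contraction openU G_metric KU Phi_flow FfK PhiK
    rho0 nu0 m0 fb lyapn decr Kx (tracking_self k f G Phi x) (tr x y Kx)
    xx (r_small _ _ yx)).
have clock0 x y : K x -> Theta x y 0 = 0 by move=> /(tr x y)[].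
have clockc x y : K x -> continuous (Theta x y) by move=> /(tr x y)[].
have clockr x y t : K x -> 0 <= t -> t / 2 <= Theta x y t <= 3 / 2 * t.
  by move=> /(tr x y); exact: tracking_clock.
have [x [l [tau [Kx lx tau0 hl]]]] := periodic_point F_lip Phi_flow K_compact K_nonempty
  PhiK r0 m0 mu0 clockr self contr.
have Kl : K l := shadowed_periodic_point F_lip Phi_flow K_compact PhiK r0 m0 mu0
  clock0 clockc clockr self Kx lx tau0 hl.
have OK : range (Phi^~ l) `<=` K := orbit_sub F_lip Phi_flow PhiK Kl tau0 hl.
have onK z : K z -> U z /\ F z = f z by move=> Kz; apply: (Ff z Kz); rewrite subrr normr0.
exists (range (Phi^~ l)); split; last first.
  apply: (attracting_exponentially_stable F_lip Phi_flow rho0 Ff _ OK r0 m0 _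
    (orbit_attraction F_lip Phi_flow PhiK m0 mu0 clock0 clockc clockr self Kl tau0 hl)).
    exact: (orbit_compact F_lip Phi_flow tau0 hl).
  by rewrite mulr_gt0// divr_gt0.
split.
  split=> //; exists (Phi^~ l), tau; split=> //.
  - split=> //; first exact: openT.
    move=> t _; have [Ut <-] : U (Phi t l) /\ F (Phi t l) = f (Phi t l).
      by apply: onK; apply: OK; exists t.
    by split=> //; exact: Phi_flow.2.
  - by move=> t; rewrite (flowD _ _ _ F_lip Phi_flow) hl.
  - (* A one-point orbit would be an equilibrium. *)
    apply: contrapT => nc; apply: (no_equilibrium l Kl).
    have cst_l : Phi^~ l = cst l.
      apply/funext => t; apply: contrapT => tl; apply: nc; exists t, 0.
      by rewrite (Phi_flow.1 l).
    have [_] := Phi_flow.2 l 0; rewrite cst_l derive_cst (Phi_flow.1 l).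
    by rewrite (onK l Kl).2.
move=> O' [[phi [T [[_ _ _ sol] T0 per _ ->]]] subK].
have dphi (t : R) : is_derive t 1 phi (F (phi t)).
  have Kt : K (phi t) by apply: subK; exists t.
  by rewrite (onK _ Kt).2; exact: (sol t I).2.
have phiE := flow_unique F_lip Phi_flow dphi.
have Kp : K (phi 0) by apply: subK; exists 0.
have hp : Phi T (phi 0) = phi 0 by rewrite -phiE -[T]add0r per.
have op := periodic_point_on_orbit F_lip Phi_flow r0 m0 mu0 clock0 clockc clockr self
  Kl tau0 hl K_connected Kp T0 hp.
rewrite -(orbit_eq F_lip Phi_flow op).
by apply/seteqP; split=> _ [t _ <-]; exists t.
Qed.
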